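(* Let $r>0$ and $(x,t)\in\mathbb V_0^{d+1}$. Then for $\beta>-d$ and $\gamma>-1$, $$\mathsf w_{\beta,\gamma}\big(\mathsf c((x,t),r)\big):=\mathsf b_{\beta,\gamma}\int_{\mathsf c((x,t),r)}\mathsf w_{\beta,\gamma}(s)\,\mathrm d\sigma(y,s)\sim r^d\,(t+r^2)^{\beta+\frac d2}\,(1-t+r^2)^{\gamma+\frac12}.$$ In particular, $\mathsf w_{\beta,\gamma}$ is a doubling weight on $\mathbb V_0^{d+1}$ and its doubling index is given by $$\alpha(\mathsf w_{\beta,\gamma})=d+2\max\{0,\beta+\tfrac d2\}+2\max\{0,\gamma+\tfrac12\}.$$
   Context: Here $d\ge2$. The conic surface is $\mathbb V_0^{d+1}=\{(x,t):\|x\|=t,\ x\in\mathbb R^d,\ 0\le t\le1\}$ with surface measure $\mathrm d\sigma(y,s)=s^{d-1}\,\mathrm d\sigma_{\mathbb S}(\eta)\,\mathrm ds$ for $y=s\eta$, $\eta\in\mathbb S^{d-1}$, $\sigma_{\mathbb S}$ the surface measure of the unit sphere $\mathbb S^{d-1}$. Its distance is $\mathsf d_{\mathbb V_0}((x,t),(y,s))=\arccos\Big(\sqrt{\tfrac{\langle x,y\rangle+ts}{2}}+\sqrt{1-t}\sqrt{1-s}\Big)$, and $\mathsf c((x,t),r)=\{(y,s)\in\mathbb V_0^{d+1}:\mathsf d_{\mathbb V_0}((x,t),(y,s))\le r\}$. The Jacobi weight is $\mathsf w_{\beta,\gamma}(t)=t^\beta(1-t)^\gamma$, $0<t<1$,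 and $\mathsf b_{\beta,\gamma}$ is the constant for which $\mathsf b_{\beta,\gamma}\mathsf w_{\beta,\gamma}$ has unit integral on $\mathbb V_0^{d+1}$. For a weight $\mathsf w$, write $\mathsf w(E)$ for its integral over $E$; $\mathsf w$ is a doubling weight if there is a constant $L$ with $\mathsf w(\mathsf c((x,t),2r))\le L\,\mathsf w(\mathsf c((x,t),r))$ for all $(x,t)$ and all $r>0$. A doubling index $\alpha(\mathsf w)$ of $\mathsf w$ is a positive number such that $\mathsf w(\mathsf c((x,t),2^mr))\le c\,2^{\alpha(\mathsf w)m}\,\mathsf w(\mathsf c((x,t),r))$ for all $(x,t)$, $r>0$, $m=1,2,\dots$, with $c$ depending only on the doubling constant of $\mathsf w$. $A\sim B$ means $c'A\le B\le cA$ with positive constants $c,c'$ that depend only on the fixed parameters.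
   Formalization: The equivalence ∼ is stated for 0 < r ≤ r0 with r0 > 0 arbitrary and constants depending also on r0, since for all r > 0 it fails: once r ≥ π/2 the left side is 1 while the right side is generally unbounded in r. *)

(* Defs.v *)
From HB Require Import structures.
From mathcomp Require Import all_boot all_order all_algebra.
From mathcomp Require Import all_classical all_reals all_analysis.
From mathcomp Require Import measurable_realfun.

Set Implicit Arguments.
Unset Strict Implicit.
Unset Printing Implicit Defensive.

Import Order.TTheory GRing.Theory Num.Theory.
Import numFieldNormedType.Exports.

Local Open Scope classical_set_scope.
Local Open Scope ring_scope.

(* R^d is the type d.-tuple R, with its product sigma-algebra. *)

Section Euclidean.
Context {R : realType} {d : nat}.
Implicit Types x y : d.-tuple R.

Definition dotp x y : R := \sum_(i < d) tnth x i * tnth y i.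

Definition enorm x : R := Num.sqrt (dotp x x).

Definition tscale (a : R) x : d.-tuple R := [tuple a * tnth x i | i < d].

Definition unit_sphere : set (d.-tuple R) := [set x | enorm x = 1].

Lemma measurable_dotp : measurable_fun setT (fun x => dotp x x).
Proof.
apply: measurable_sum => i; apply: measurable_funM; exact: measurable_tnth.
Qed.

Lemma measurable_enorm : measurable_fun setT enorm.
Proof.
apply: (measurableT_comp _ measurable_dotp).
apply: continuous_measurable_fun; exact: sqrt_continuous.
Qed.

Definition normalize x : d.-tuple R := tscale (enorm x)^-1 x.

Lemma measurable_normalize : measurable_fun setT normalize.
Proof.
apply/measurable_fun_tnthP => i.
rewrite (_ : _ \o _ = fun x => enorm x `^ (-1) * tnth x i); last first.
  apply/funext => x /=; rewrite tnth_mktuple powR_inv1//.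
  exact: sqrtr_ge0.
apply: measurable_funM; last exact: measurable_tnth.
exact: (measurableT_comp (measurable_powR (-1)) measurable_enorm).
Qed.

Definition punctured_ball : set (d.-tuple R) := [set x | 0 < enorm x <= 1].

Lemma measurable_punctured_ball : measurable punctured_ball.
Proof.
rewrite (_ : punctured_ball = setT `&` enorm @^-1` `]0, 1]); last first.
  by rewrite setTI; apply/seteqP; split => x /=; rewrite in_itv.
by apply: measurable_enorm => //; exact: measurable_itv.
Qed.

End Euclidean.

Section lebesgue_cons.
Local Open Scope ereal_scope.
Context {R : realType} (k : nat).
Variable m : {sigma_finite_measure set (k.-tuple R) -> \bar R}.

Let cons_tup (p : R * k.-tuple R) : k.+1.-tuple R := [tuple of p.1 :: p.2].

Let mcons_tup : measurable_fun setT cons_tup.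
Proof. exact: measurable_cons. Qed.

Definition lebesgue_cons : set (k.+1.-tuple R) -> \bar R :=
  pushforward (@lebesgue_measure R \x m) cons_tup.

Let lebesgue_cons0 : lebesgue_cons set0 = 0.
Proof. exact: measure0. Qed.

Let lebesgue_cons_ge0 A : 0 <= lebesgue_cons A.
Proof. exact: measure_ge0. Qed.

Let lebesgue_cons_sigma_additive : semi_sigma_additive lebesgue_cons.
Proof. exact: measure_semi_sigma_additive. Qed.

HB.instance Definition _ := isMeasure.Build _ _ _ lebesgue_cons
  lebesgue_cons0 lebesgue_cons_ge0 lebesgue_cons_sigma_additive.

Let lebesgue_cons_sigma_finite : sigma_finite setT lebesgue_cons.
Proof.
have /sigma_finiteP[F [TF ndF Foo]] := sigma_finiteT (@lebesgue_measure R).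
have /sigma_finiteP[G [TG ndG Goo]] := sigma_finiteT m.
pose h (x : k.+1.-tuple R) : R * k.-tuple R := (thead x, [tuple of behead x]).
have mh : measurable_fun setT h.
  apply: measurable_fun_pair; last exact: measurable_behead.
  exact: measurable_tnth.
have hK p : h (cons_tup p) = p.
  by case: p => a t; congr pair; exact/val_inj.
exists (fun n => h @^-1` (F n `*` G n)).
  apply/esym; rewrite -subTset => x _.
  have [i _ Fi] : (\bigcup_i F i) (h x).1 by rewrite -TF.
  have [j _ Gj] : (\bigcup_j G j) (h x).2 by rewrite -TG.
  exists (maxn i j) => //; split.
  - by move: Fi; exact/subsetPset/ndF/leq_maxl.
  - by move: Gj; exact/subsetPset/ndG/leq_maxr.
move=> n; have [mF Fn] := Foo n; have [mG Gn] := Goo n.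
split.
  by rewrite -[X in measurable X]setTI; apply: mh => //; exact: measurableX.
rewrite /lebesgue_cons /pushforward -comp_preimage.
rewrite (_ : h \o cons_tup = id); last by apply/funext => p; exact: hK.
by rewrite preimage_id product_measure1E// lte_mul_pinfty// ge0_fin_numE.
Qed.

HB.instance Definition _ := Measure_isSigmaFinite.Build _ _ _ lebesgue_cons
  lebesgue_cons_sigma_finite.

End lebesgue_cons.

Fixpoint lebesgue_tuple (R : realType) (n : nat) :
    {sigma_finite_measure set (n.-tuple R) -> \bar R} :=
  match n with
  | 0 => \d_([tuple] : 0.-tuple R)
  | k.+1 => lebesgue_cons (lebesgue_tuple R k)
  end.

Section sphere_measure.
Local Open Scope ereal_scope.
Context (R : realType) (d : nat).

(* The surface measure of the unit sphere is d times the Lebesgue measure of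
   the solid cone {rho * eta : 0 < rho <= 1, eta in A} over A (this makes
   du = rho^(d-1) dsigma(eta) drho hold for u = rho * eta); it is carried by
   unit_sphere. *)
Definition sphere_measure (A : set (d.-tuple R)) : \bar R :=
  d%:R%:E * lebesgue_tuple R d (normalize @^-1` A `&` punctured_ball).

Let restr : {measure set (d.-tuple R) -> \bar R} :=
  mrestr (lebesgue_tuple R d) measurable_punctured_ball.

Let mnormalize : measurable_fun setT (@normalize R d).
Proof. exact: measurable_normalize. Qed.

Let push := pushforward restr (@normalize R d).
Let push0 : push set0 = 0. Proof. exact: measure0. Qed.
Let push_ge0 A : 0 <= push A. Proof. exact: measure_ge0. Qed.
Let push_sigma_additive : semi_sigma_additive push.
Proof. exact: measure_semi_sigma_additive. Qed.
HB.instance Definition _ := isMeasure.Build _ _ _ push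
  push0 push_ge0 push_sigma_additive.

Let scale : {measure set (d.-tuple R) -> \bar R} :=
  mscale (NngNum (ler0n R d)) push.

Let sphere_measure0 : sphere_measure set0 = 0.
Proof. exact: (measure0 scale). Qed.

Let sphere_measure_ge0 A : 0 <= sphere_measure A.
Proof. exact: (measure_ge0 scale). Qed.

Let sphere_measure_sigma_additive : semi_sigma_additive sphere_measure.
Proof. exact: (@measure_semi_sigma_additive _ _ _ scale). Qed.

HB.instance Definition _ := isMeasure.Build _ _ _ sphere_measure
  sphere_measure0 sphere_measure_ge0 sphere_measure_sigma_additive.

End sphere_measure.

Section conic_surface.
Context {R : realType} {d : nat}.
Implicit Types (p q : d.-tuple R * R) (E : set (d.-tuple R * R)).
Implicit Types (w : d.-tuple R * R -> R).

Definition conic_surface : set (d.-tuple R * R) :=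
  [set p | enorm p.1 = p.2 /\ 0 <= p.2 <= 1].

Definition cone_dist p q : R :=
  acos (Num.sqrt ((dotp p.1 q.1 + p.2 * q.2) / 2)
        + Num.sqrt (1 - p.2) * Num.sqrt (1 - q.2)).

(* cone_dist takes values in [0, pi / 2] on the surface, so a cap of radius
   r >= pi / 2 is the whole surface. *)
Definition cone_cap p (r : R) : set (d.-tuple R * R) :=
  [set q | conic_surface q /\ cone_dist p q <= r].

(* The integral of f over E for the surface measure s^(d-1) dsigma(eta) ds,
   written at the point (s * eta, s). *)
Definition cone_integral E (f : d.-tuple R * R -> \bar R) : \bar R :=
  (\int[lebesgue_measure]_(s in `[0%R, 1%R])
     \int[@sphere_measure R d]_(eta in
         unit_sphere `&` [set eta | E (tscale s eta, s)])
       (f (tscale s eta, s) * (s ^+ d.-1)%:E))%E.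

Definition weight_mass w E : \bar R := cone_integral E (EFin \o w).

Definition doubling_weight w : Prop :=
  exists L : R, forall p r, conic_surface p -> 0 < r ->
    (weight_mass w (cone_cap p (2 * r)) <= L%:E * weight_mass w (cone_cap p r))%E.

(* For a single weight, a constant that depends only on its doubling constant
   is one that does not depend on p, r and m. *)
Definition doubling_index w (alpha : R) : Prop :=
  0 < alpha /\ exists2 c : R, 0 < c & forall p r (m : nat),
    conic_surface p -> 0 < r -> (0 < m)%N ->
    (weight_mass w (cone_cap p (2 ^+ m * r))
     <= (c * 2 `^ (alpha * m%:R))%:E * weight_mass w (cone_cap p r))%E.

(* The values of powR at t = 0 and t = 1 are irrelevant: these two levels are
   null sets of the surface measure. *)
Definition jacobi_weight (beta gamma : R) p : R :=
  p.2 `^ beta * (1 - p.2) `^ gamma.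

Definition jacobi_const (beta gamma : R) : R :=
  (fine (weight_mass (jacobi_weight beta gamma) conic_surface))^-1.

Definition jacobi_mass (beta gamma : R) E : \bar R :=
  ((jacobi_const beta gamma)%:E * weight_mass (jacobi_weight beta gamma) E)%E.

End conic_surface.

(* Main.v *)
Require Import Defs.
From mathcomp Require Import all_boot all_order all_algebra.
From mathcomp Require Import all_classical all_reals all_analysis.
From mathcomp Require Import measurable_realfun ring lra.

(* Write x = t xi and y = s eta with unit vectors xi, eta, and put
   T = t + r^2, V = 1 - t + r^2.  Then
     cos d((x,t),(y,s)) = sqrt(t s (1 + <xi,eta>) / 2) + sqrt((1-t)(1-s)),
   so, up to constants, (y,s) lies in the cap of radius r iff
   |sqrt s - sqrt t| <= r, |sqrt(1-s) - sqrt(1-t)| <= r and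
   sqrt(t s) (1 - <xi,eta>) <= r^2.  On the cap the last condition confines eta
   to a spherical cap of radius comparable to r / sqrt T, whose measure is of
   order (r / sqrt T)^(d-1): the solid cone over a spherical cap of radius rho
   is covered by about 1/rho cubes of side about rho centred on the ray through
   xi, and contains about as many disjoint ones.  The radial integral of
   s^(beta+d-1) (1-s)^gamma over the remaining interval is of order
   r T^(beta+d-1/2) V^(gamma+1/2); near the singular levels t = 0 and t = 1
   this is the bound a^(p+1) for the integral of s^p over [0,a], p > -1. *)

Set Implicit Arguments.
Unset Strict Implicit.
Unset Printing Implicit Defensive.

Import Order.TTheory GRing.Theory Num.Theory.
Import numFieldNormedType.Exports.

Local Open Scope classical_set_scope.
Local Open Scope ring_scope.

(** The surface is split at t = 1/2. On either half only one of the factors s^p (p = beta + d - 1)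
    and (1-s)^gamma can be singular, and over a cap of radius at most 1/4 the other one is bounded
    by a constant; hence only integrals of a single power occur, and the substitution of 1 - s for s
    serves the second half.

    For the lower bound the levels next to t are unsuitable: at t = 0 the power s^p may vanish or
    blow up. The levels used instead lie between L and 2 L away from t, on the side of the farther
    end, with L = r sqrt T / 64 for t <= 1/2 and L = r sqrt V / 64 otherwise. This is far enough for
    s to be comparable to T and 1 - s to V, and near enough to stay in the cap.

    The mass is an iterated integral whose inner integral is not shown to be measurable in s, so
    every estimate compares nonnegative integrands pointwise.

    The equivalence is stated for r <= r0, with constants depending on r0: for r >= pi / 2 the mass
    is constant, whereas the right-hand side has order r^(2 beta + 2 gamma + 2 d + 1) as r grows.
    Doubling needs only r0 = 2, since larger caps are the whole surface. *)

Section real_lemmas.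
Context {R : realType}.
Implicit Types a b c l p r s t u : R.

(** * Real powers of comparable numbers *)

Lemma powR_le_growth l p a b : 1 <= l -> 0 < a -> a <= b -> b <= l * a ->
  b `^ p <= l `^ (Num.max 0 p) * a `^ p.
Proof.
move=> l1 a0 ab bla; have b0 : 0 < b by exact: lt_le_trans ab.
have l0 : 0 < l by exact: lt_le_trans l1.
have [p0|p0] := leP 0 p.
  rewrite -powRM ?(ltW l0) ?(ltW a0)//; apply: ge0_ler_powR => //.
    by rewrite nnegrE ltW.
  by rewrite nnegrE mulr_ge0// ltW.
rewrite powRr0 mul1r -(opprK p) !(powRN _ (- p)) lef_pV2 ?posrE ?powR_gt0//.
by apply: ge0_ler_powR; rewrite ?nnegrE ?oppr_ge0 ?(ltW a0) ?(ltW b0) ?(ltW p0).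
Qed.

(** Comparability is symmetric in [a] and [b], so a negative exponent reduces to [- p] by inverting
    both powers. Weight exponents of either sign are thereby treated alike. *)
Lemma powR_le_comparable l p a b : 1 <= l -> 0 < a -> 0 < b ->
  a <= l * b -> b <= l * a -> a `^ p <= l `^ `|p| * b `^ p.
Proof.
move=> l1 a0 b0 alb bla; have l0 : 0 < l by exact: lt_le_trans l1.
have [p0|p0] := leP 0 p.
  rewrite ger0_norm// -powRM ?(ltW l0) ?(ltW b0)//; apply: ge0_ler_powR => //.
    by rewrite nnegrE ltW.
  by rewrite nnegrE mulr_ge0// ltW.
rewrite (ltr0_norm p0) -{1 3}(opprK p) !(powRN _ (- p)) -lef_pV2 ?posrE; last 2 first.
- by rewrite mulr_gt0 ?powR_gt0// invr_gt0 powR_gt0.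
- by rewrite invr_gt0 powR_gt0.
rewrite invrK invfM invrK -ler_pdivlMl ?invr_gt0 ?powR_gt0// invrK.
rewrite -powRM ?(ltW l0) ?(ltW a0)//; apply: ge0_ler_powR => //.
- by rewrite oppr_ge0 ltW.
- by rewrite nnegrE ltW.
- by rewrite nnegrE mulr_ge0// ltW.
Qed.

Lemma powR_ge_unit l p a : 1 <= l -> 1 <= l * a -> a <= l ->
  1 <= l `^ `|p| * a `^ p.
Proof.
move=> l1 la al; have a0 : 0 < a by nra.
rewrite -[leLHS](_ : 1 `^ p = 1); last by rewrite powR1.
by apply: powR_le_comparable; rewrite ?mulr1.
Qed.

Lemma powR_le_unit l p a : 1 <= l -> a <= 1 -> 1 <= l * a ->
  a `^ p <= l `^ `|p|.
Proof.
move=> l1 a1 la; have a0 : 0 < a by nra.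
rewrite -[leRHS]mulr1 -[X in _ * X](_ : 1 `^ p = 1); last by rewrite powR1.
by apply: powR_le_comparable; rewrite ?mulr1//; lra.
Qed.

(** Here [y] stands for the factor that is regular on the current half of the surface: [1 <= b * y]
    inserts it into a bound that lacks it, and [c] leaves room for the constant of the other
    half. *)
Lemma ler_mul_absorb a b c x y : 0 <= a -> 0 <= c -> 0 <= x * y -> 0 <= x ->
  1 <= b * y -> a * x <= (a * b + c) * (x * y).
Proof.
move=> a0 c0 xy0 x0 by1; have := ler_wpM2l (mulr_ge0 a0 x0) by1.
by have := mulr_ge0 c0 xy0; lra.
Qed.

Lemma sqrtM_le_mean a b : 0 <= a -> 0 <= b ->
  Num.sqrt a * Num.sqrt b <= (a + b) / 2.
Proof.
move=> a0 b0; have := sqr_ge0 (Num.sqrt a - Num.sqrt b).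
by rewrite sqrrB !sqr_sqrtr//; lra.
Qed.

(** * Levels close to a given one, measured by square roots *)

Lemma mulr_sqr_sqrtB_le a b : 0 <= a -> 0 < b ->
  b * (Num.sqrt a - Num.sqrt b) ^+ 2 <= (b - a) ^+ 2.
Proof.
move=> a0 b0; have aE : a = Num.sqrt a ^+ 2 by rewrite sqr_sqrtr.
have bE : b = Num.sqrt b ^+ 2 by rewrite sqr_sqrtr// ltW.
rewrite {1}bE [in leRHS]aE [in leRHS]bE subr_sqr exprMn.
have -> : (Num.sqrt b - Num.sqrt a) ^+ 2 = (Num.sqrt a - Num.sqrt b) ^+ 2 by ring.
rewrite mulrC; apply: ler_wpM2l; first exact: sqr_ge0.
by apply: lerXn2r; rewrite ?nnegrE ?addr_ge0 ?sqrtr_ge0// lerDl sqrtr_ge0.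
Qed.

Lemma level_away_from_one t s r : 0 <= t <= 1 / 2 -> 0 <= s -> r <= 1 / 4 ->
  `|Num.sqrt s - Num.sqrt t| <= r -> 1 <= 16 * (1 - s).
Proof.
move=> /andP[t0 t12] s0 r4; rewrite ler_norml => /andP[_ hs].
(* A rational between 1/sqrt 2 + 1/4, which bounds sqrt s, and sqrt 15 / 4, whose square is 1 -
   1/16. *)
have h : Num.sqrt s <= 121 / 125.
  have : Num.sqrt t ^+ 2 <= 1 / 2 by rewrite sqr_sqrtr.
  by have := sqrtr_ge0 t; rewrite expr2; nra.
have : s = Num.sqrt s ^+ 2 by rewrite sqr_sqrtr.
by have := sqrtr_ge0 s; rewrite expr2; nra.
Qed.

(* Beyond distance [L] from [t] towards [1/2] the level [s] is comparable to
   [t + r^2], even when [t] vanishes. *)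
Lemma shifted_level_range t s r L : 0 <= t <= 1 / 2 -> 0 < r <= 1 ->
  L = 64^-1 * (r * Num.sqrt (t + r ^+ 2)) -> t + L <= s <= t + 2 * L ->
  0 < s <= 3 / 4 /\ s <= 2 * (t + r ^+ 2) /\ t + r ^+ 2 <= 64 * s.
Proof.
move=> /andP[t0 t12] /andP[r0 r1] LE /andP[sl su].
have r20 : 0 < r ^+ 2 by rewrite exprn_gt0.
have T0 : 0 < t + r ^+ 2 by lra.
have TE : t + r ^+ 2 = Num.sqrt (t + r ^+ 2) ^+ 2 by rewrite sqr_sqrtr// ltW.
have rT : r <= Num.sqrt (t + r ^+ 2).
  by rewrite -(@ler_pXn2r _ 2)// ?nnegrE ?sqrtr_ge0 ?(ltW r0)// -TE lerDr.
have Lr : r ^+ 2 <= 64 * L by rewrite LE mulVKf// expr2 ler_pM2l.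
have LT : 64 * L <= t + r ^+ 2.
  by rewrite LE mulVKf// [leRHS]TE expr2 ler_wpM2r// sqrtr_ge0.
have r21 : r ^+ 2 <= 1 by rewrite expr2; nra.
by split; [apply/andP; split|split]; lra.
Qed.

(** Since s - t = (sqrt s - sqrt t)(sqrt s + sqrt t), the first square is at most (s-t)^2 / s. With
    (s-t)^2 <= 4 L^2 and s >= T/64 this is at most r^2/16. The second is at most (s-t)^2 / (1-s),
    where 1 - s >= 1/4 and T <= 2 give r^2/128. *)
Lemma shifted_level_sqr_sqrt t s r L : 0 <= t <= 1 / 2 -> 0 < r <= 1 ->
  L = 64^-1 * (r * Num.sqrt (t + r ^+ 2)) -> t + L <= s <= t + 2 * L ->
  (Num.sqrt t - Num.sqrt s) ^+ 2
    + (Num.sqrt (1 - t) - Num.sqrt (1 - s)) ^+ 2 <= r ^+ 2 / 4.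
Proof.
move=> t02 r01 LE sL; have [/andP[s0 s34] [_ Ts]] := shifted_level_range t02 r01 LE sL.
have /andP[t0 t12] := t02; have /andP[r0 r1] := r01; have /andP[sl su] := sL.
have r20 : 0 < r ^+ 2 by rewrite exprn_gt0.
have s10 : 0 < 1 - s by lra.
have t10 : 0 <= 1 - t by lra.
have := mulr_sqr_sqrtB_le t0 s0; have := mulr_sqr_sqrtB_le t10 s10.
have -> : (1 - s - (1 - t)) ^+ 2 = (s - t) ^+ 2 by ring.
have T2 : r ^+ 2 * (t + r ^+ 2) <= r ^+ 2 * 2.
  by apply: ler_wpM2l; [exact: ltW|rewrite expr2; nra].
have T0 : 0 < t + r ^+ 2 by lra.
have LL : L ^+ 2 = 64^-1 ^+ 2 * (r ^+ 2 * (t + r ^+ 2)).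
  by rewrite LE !exprMn sqr_sqrtr// ltW.
have st2 : (s - t) ^+ 2 <= 4 * L ^+ 2 by rewrite !expr2; nra.
rewrite LL in st2.
move: (t + r ^+ 2) T0 Ts T2 st2 => T T0 Ts T2 st2.
move: ((s - t) ^+ 2) st2 => e st2.
have := sqr_ge0 (Num.sqrt t - Num.sqrt s).
have := sqr_ge0 (Num.sqrt (1 - t) - Num.sqrt (1 - s)).
move: ((_ - _) ^+ 2) ((_ - _) ^+ 2) => a b b0 a0 hb ha.
have {}hb : b <= 128^-1 * r ^+ 2.
  have : 4^-1 * b <= (1 - s) * b by apply: ler_wpM2r => //; lra.
  by lra.
have {ha}: T * a <= T * (16^-1 * r ^+ 2).
  have : T * a <= 64 * s * a by exact: ler_wpM2r.
  by lra.
by rewrite ler_pM2l//; lra.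
Qed.

Lemma shifted_level_bounds t s r L : 0 <= t <= 1 / 2 -> 0 < r <= 1 ->
  L = 64^-1 * (r * Num.sqrt (t + r ^+ 2)) -> t + L <= s <= t + 2 * L ->
  [/\ 0 < s < 1, s <= 64 * (t + r ^+ 2) /\ t + r ^+ 2 <= 64 * s,
      1 - s <= 64 * (1 - t + r ^+ 2) /\ 1 - t + r ^+ 2 <= 64 * (1 - s),
      (Num.sqrt t - Num.sqrt s) ^+ 2
        + (Num.sqrt (1 - t) - Num.sqrt (1 - s)) ^+ 2 <= r ^+ 2 / 4 &
      Num.sqrt t * Num.sqrt s <= 2 * (t + r ^+ 2)].
Proof.
move=> t02 r01 LE sL; have hs := shifted_level_sqr_sqrt t02 r01 LE sL.
have [/andP[s0 s34] [sT Ts]] := shifted_level_range t02 r01 LE sL.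
have /andP[t0 t12] := t02; have /andP[r0 r1] := r01.
have hts := sqrtM_le_mean t0 (ltW s0).
have r21 : r ^+ 2 <= 1 by rewrite expr2; nra.
have r20 := sqr_ge0 r.
by split; [apply/andP; split; lra|split; lra|split; lra| |lra].
Qed.

Lemma sin_eq_cosM r : 0 <= r -> exists2 c : R, 0 <= c <= r & sin r = cos c * r :> R.
Proof.
rewrite le_eqVlt => /predU1P[<-|r0].
  by exists 0; rewrite ?lexx// sin0 mulr0.
have [|c] := @MVT R sin cos 0 r r0 (fun x _ => is_derive_sin x).
  exact/continuous_subspaceT/continuous_sin.
by rewrite in_itv/= sin0 !subr0 => /andP[c0 cr] ->; exists c; rewrite ?(ltW c0) ?(ltW cr).
Qed.

Lemma cosE_sin_half r : cos r = 1 - 2 * sin (r / 2) ^+ 2.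
Proof.
rewrite sin2cos2 {1}(_ : r = (r / 2) *+ 2); last by rewrite -mulr_natr mulfVK.
by rewrite cos_mulr2n; lra.
Qed.

Lemma cos_ge_quadratic r : 0 <= r -> 1 - r ^+ 2 / 2 <= cos r.
Proof.
move=> r0; rewrite cosE_sin_half.
have [c c0 ->] := @sin_eq_cosM (r / 2) ltac:(lra).
rewrite exprMn; have : cos c ^+ 2 <= 1.
  by have := cos2Dsin2 c; have := sqr_ge0 (sin c); lra.
by have := sqr_ge0 r; nra.
Qed.

Lemma cos_le_quadratic r : 0 <= r <= 1 -> cos r <= 1 - r ^+ 2 / 4.
Proof.
move=> /andP[r0 r1]; rewrite cosE_sin_half.
have [c /andP[c0 cr] ->] := @sin_eq_cosM (r / 2) ltac:(lra).
(* The mean value point satisfies c <= r/2 <= 1/2, whence 1 - c^2/2 >= 7/8. The quadratic term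
   becomes 49 r^2 / 128, which exceeds r^2/4. *)
have c78 : 7 / 8 <= cos c.
  by have := cos_ge_quadratic c0; rewrite expr2; nra.
rewrite exprMn; have : 49 / 64 <= cos c ^+ 2 by rewrite expr2; nra.
by have := sqr_ge0 r; rewrite !expr2; nra.
Qed.

End real_lemmas.

(** * The distance in polar coordinates and its elementary bounds *)

Section conic_distance.
Context {R : realType} {d : nat}.
Implicit Types x y : d.-tuple R.
Implicit Types a b r s t u : R.

Lemma tnth_tscale a x i : tnth (tscale a x) i = a * tnth x i.
Proof. exact: tnth_mktuple. Qed.

Lemma dotpZ a b x y : dotp (tscale a x) (tscale b y) = a * b * dotp x y.
Proof.
rewrite /dotp big_distrr/=; apply: eq_bigr => i _.
by rewrite !tnth_tscale; ring.
Qed.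

Lemma dotpC x y : dotp x y = dotp y x.
Proof. by apply: eq_bigr => i _; rewrite mulrC. Qed.

Lemma dotp_ge0 x : 0 <= dotp x x.
Proof. by apply: sumr_ge0 => i _; rewrite -expr2 sqr_ge0. Qed.

Lemma enorm_sqr x : enorm x ^+ 2 = dotp x x.
Proof. by rewrite sqr_sqrtr// dotp_ge0. Qed.

Lemma enorm_ge0 x : 0 <= enorm x. Proof. exact: sqrtr_ge0. Qed.

Lemma enormZ a x : 0 <= a -> enorm (tscale a x) = a * enorm x.
Proof.
by move=> a0; rewrite /enorm dotpZ -expr2 sqrtrM ?sqr_ge0// sqrtr_sqr ger0_norm.
Qed.

Lemma tscaleA a b x : tscale a (tscale b x) = tscale (a * b) x.
Proof. by apply: eq_from_tnth => i; rewrite !tnth_tscale mulrA. Qed.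

Lemma tscale1 x : tscale 1 x = x.
Proof. by apply: eq_from_tnth => i; rewrite tnth_tscale mul1r. Qed.

Lemma enorm_normalize x : 0 < enorm x -> enorm (normalize x) = 1.
Proof.
by move=> x0; rewrite enormZ ?invr_ge0 ?enorm_ge0// mulVf// gt_eqF.
Qed.

Lemma tscale_normalize x : 0 < enorm x -> tscale (enorm x) (normalize x) = x.
Proof. by move=> x0; rewrite tscaleA divff ?gt_eqF// tscale1. Qed.

Lemma enorm_eq0 x : enorm x = 0 -> forall i, tnth x i = 0.
Proof.
move=> x0 i; have : dotp x x = 0 by rewrite -enorm_sqr x0 expr0n.
move=> /eqP; rewrite psumr_eq0; last by move=> j _; rewrite -expr2 sqr_ge0.
by move=> /allP/(_ i); rewrite mem_index_enum mulf_eq0 orbb => /(_ isT)/eqP.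
Qed.

Lemma sum_sqrB_unit x y (x1 : enorm x = 1) (y1 : enorm y = 1) :
  \sum_(i < d) (tnth x i - tnth y i) ^+ 2 = 2 * (1 - dotp x y).
Proof.
transitivity (dotp x x + dotp y y - 2 * dotp x y).
  rewrite /dotp big_distrr -big_split/= -sumrB; apply: eq_bigr => i _; ring.
by rewrite -!enorm_sqr x1 y1 expr1n; ring.
Qed.

Lemma dotp_unit_bounds x y : enorm x = 1 -> enorm y = 1 -> -1 <= dotp x y <= 1.
Proof.
move=> x1 y1; have := sum_sqrB_unit x1 y1.
have : enorm (tscale (-1) y) = 1.
  by rewrite /enorm dotpZ mulrNN !mul1r -enorm_sqr y1 expr1n sqrtr1.
move=> /(sum_sqrB_unit x1).
have -> : dotp x (tscale (-1) y) = - dotp x y.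
  by rewrite -{1}(tscale1 x) dotpZ; ring.
set A := \sum_(_ < _) _; set B := \sum_(_ < _) _ => hA hB.
have : 0 <= A by apply: sumr_ge0 => i _; exact: sqr_ge0.
have : 0 <= B by apply: sumr_ge0 => i _; exact: sqr_ge0.
by lra.
Qed.

Lemma exists_unit : (0 < d)%N -> exists x : d.-tuple R, enorm x = 1.
Proof.
move=> d0; exists [tuple (i == Ordinal d0)%:R | i < d].
rewrite /enorm /dotp (bigD1 (Ordinal d0))//= big1 => [|i i0].
  by rewrite !tnth_mktuple eqxx mulr1 addr0 sqrtr1.
by rewrite !tnth_mktuple (negPf i0) mulr0.
Qed.

Lemma conic_surface_polar (p : d.-tuple R * R) : (0 < d)%N -> conic_surface p ->
  exists2 xi : d.-tuple R, enorm xi = 1 & p.1 = tscale p.2 xi.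
Proof.
case: p => x t /= d0 [/= xt /andP[]]; rewrite le_eqVlt => /predU1P[t0|t0] _.
  (* At the apex every direction represents the point, so an arbitrary unit vector is chosen. *)
  have [xi xi1] := exists_unit d0; exists xi => //.
  apply: eq_from_tnth => i; rewrite tnth_tscale -t0 mul0r.
  by apply: enorm_eq0; rewrite xt.
exists (normalize x); first by rewrite enorm_normalize ?xt.
by rewrite -xt tscale_normalize// xt.
Qed.

Definition cos_cone_dist t s u : R :=
  Num.sqrt t * Num.sqrt s * Num.sqrt ((1 + u) / 2)
  + Num.sqrt (1 - t) * Num.sqrt (1 - s).

(** One minus the cosine of the distance is a sum of nonnegative terms: a height term sensitive near
    the apex, one sensitive near the rim, and an angular term. A bound on the distance therefore
    bounds each of them separately. *)
Lemma cos_cone_distE t s u : 0 <= t <= 1 -> 0 <= s <= 1 -> -1 <= u <= 1 ->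
  cos_cone_dist t s u = 1
    - ((Num.sqrt t - Num.sqrt s) ^+ 2
       + (Num.sqrt (1 - t) - Num.sqrt (1 - s)) ^+ 2) / 2
    - Num.sqrt t * Num.sqrt s * (1 - Num.sqrt ((1 + u) / 2)).
Proof.
move=> /andP[t0 t1] /andP[s0 s1] u1; rewrite /cos_cone_dist !sqrrB.
by rewrite !sqr_sqrtr ?subr_ge0//; field.
Qed.

Lemma sqrt_half_bounds u : -1 <= u <= 1 ->
  [/\ 0 <= Num.sqrt ((1 + u) / 2), Num.sqrt ((1 + u) / 2) <= 1 &
      Num.sqrt ((1 + u) / 2) ^+ 2 = (1 + u) / 2].
Proof.
move=> u1; split; first exact: sqrtr_ge0.
  by rewrite -[leRHS]sqrtr1 ler_wsqrtr//; lra.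
by rewrite sqr_sqrtr//; lra.
Qed.

Lemma cos_cone_dist_bounds t s u : 0 <= t <= 1 -> 0 <= s <= 1 -> -1 <= u <= 1 ->
  0 <= cos_cone_dist t s u <= 1.
Proof.
move=> t01 s01 u1; apply/andP; split.
  by rewrite addr_ge0// !mulr_ge0// sqrtr_ge0.
rewrite cos_cone_distE//; have [w0 w1 _] := sqrt_half_bounds u1.
have := sqr_ge0 (Num.sqrt t - Num.sqrt s).
have := sqr_ge0 (Num.sqrt (1 - t) - Num.sqrt (1 - s)).
have : 0 <= Num.sqrt t * Num.sqrt s by rewrite mulr_ge0// sqrtr_ge0.
by nra.
Qed.

Lemma cone_capE t s (xi eta : d.-tuple R) r : 0 <= t <= 1 -> 0 <= s <= 1 ->
  enorm xi = 1 -> enorm eta = 1 ->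
  cone_cap (tscale t xi, t) r (tscale s eta, s) <->
  acos (cos_cone_dist t s (dotp xi eta)) <= r.
Proof.
move=> t01 s01 xi1 eta1.
have ts0 : 0 <= t * s by move: t01 s01 => /andP[? _] /andP[? _]; rewrite mulr_ge0.
have -> : cos_cone_dist t s (dotp xi eta) =
    Num.sqrt ((dotp (tscale t xi) (tscale s eta) + t * s) / 2)
    + Num.sqrt (1 - t) * Num.sqrt (1 - s).
  rewrite dotpZ /cos_cone_dist; congr (_ + _).
  have /andP[t0 _] := t01; rewrite -sqrtrM// -sqrtrM//.
  by congr Num.sqrt; field.
split=> [[]//|h]; split=> //; split => //=.
by have /andP[s0 _] := s01; rewrite enormZ// eta1 mulr1.
Qed.

Lemma acos_le (A r : R) : 0 <= A <= 1 -> 0 <= r <= 1 ->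
  (acos A <= r) = (cos r <= A).
Proof.
move=> /andP[A0 A1] /andP[r0 r1]; have A11 : -1 <= A <= 1 by lra.
have [/andP[ac0 acpi] acE] := acos_def A11.
rewrite -{2}acE leNgt [RHS]leNgt; congr (~~ _).
have pi2 : r <= pi by have := @pi_ge2 R; lra.
by rewrite ltr_cos// in_itv/= ?r0 ?ac0.
Qed.

(** A nonnegative cosine forces an angle of at most pi / 2. The rational bound 2 then serves as the
    radius from which a cap is the whole surface. *)
Lemma acos_le_pihalf (A : R) : 0 <= A <= 1 -> acos A <= 2.
Proof.
move=> /andP[A0 A1]; have A11 : -1 <= A <= 1 by lra.
have [/andP[ac0 acpi] acE] := acos_def A11.
apply: (@le_trans _ _ (pi / 2)); last by have /andP[] := (@pihalf_02_cos_pihalf R).1.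
rewrite leNgt; apply/negP => h.
have : cos (acos A) < cos (pi / 2).
  have := @pi_ge0 R => pi0.
  by rewrite ltr_cos// in_itv/= ?ac0// ler_pdivrMr//; apply/andP; split; lra.
by rewrite acE cos_pihalf; lra.
Qed.

(** From 1 - r^2/2 <= cos r, each nonnegative term of [cos_cone_distE] is at most r^2/2. With w =
    sqrt((1+u)/2), 1 - u = 2(1-w)(1+w) <= 4(1-w), which turns the angular bound into 2 r^2. *)
Lemma cone_dist_le t s u r : 0 <= t <= 1 -> 0 <= s <= 1 -> -1 <= u <= 1 ->
  0 <= r <= 1 -> acos (cos_cone_dist t s u) <= r ->
  [/\ `|Num.sqrt t - Num.sqrt s| <= r,
      `|Num.sqrt (1 - t) - Num.sqrt (1 - s)| <= r &
      Num.sqrt t * Num.sqrt s * (1 - u) <= 2 * r ^+ 2].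
Proof.
move=> t01 s01 u1 r01; rewrite acos_le// ?cos_cone_dist_bounds//.
have /andP[r0 _] := r01; have := cos_ge_quadratic r0.
move=> h1 h2; have {h1 h2} := le_trans h1 h2.
rewrite cos_cone_distE//; have [w0 w1 wE] := sqrt_half_bounds u1.
have h1 := sqr_ge0 (Num.sqrt t - Num.sqrt s).
have h2 := sqr_ge0 (Num.sqrt (1 - t) - Num.sqrt (1 - s)).
have h3 : 0 <= Num.sqrt t * Num.sqrt s by rewrite mulr_ge0// sqrtr_ge0.
have h4 := mulr_ge0 h3 (ltac:(lra) : 0 <= 1 - Num.sqrt ((1 + u) / 2)).
move=> h; split.
- by rewrite -ler_sqr ?nnegrE// ?real_normK ?num_real//; lra.
- by rewrite -ler_sqr ?nnegrE// ?real_normK ?num_real//; lra.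
- have uE : u = 2 * Num.sqrt ((1 + u) / 2) ^+ 2 - 1 by rewrite wE; field.
  rewrite [X in 1 - X]uE; move: (Num.sqrt _ * _) (Num.sqrt ((1 + u) / 2)) w0 w1 h h3 h4.
  by move=> a w *; nra.
Qed.

(** The height terms contribute at most r^2/8. So does the angular one, since 1 - w <= (1-w)(1+w) =
    (1-u)/2. The total r^2/4 is what [cos_le_quadratic] allows. *)
Lemma le_cone_dist t s u r : 0 <= t <= 1 -> 0 <= s <= 1 -> -1 <= u <= 1 ->
  0 <= r <= 1 ->
  (Num.sqrt t - Num.sqrt s) ^+ 2
    + (Num.sqrt (1 - t) - Num.sqrt (1 - s)) ^+ 2 <= r ^+ 2 / 4 ->
  Num.sqrt t * Num.sqrt s * (1 - u) <= r ^+ 2 / 4 ->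
  acos (cos_cone_dist t s u) <= r.
Proof.
move=> t01 s01 u1 r01 h1 h2; rewrite acos_le// ?cos_cone_dist_bounds//.
apply: le_trans (cos_le_quadratic r01) _.
rewrite cos_cone_distE//; have [w0 w1 wE] := sqrt_half_bounds u1.
have h3 : 0 <= Num.sqrt t * Num.sqrt s by rewrite mulr_ge0// sqrtr_ge0.
have uE : u = 2 * Num.sqrt ((1 + u) / 2) ^+ 2 - 1 by rewrite wE; field.
move: h2; rewrite [X in 1 - X]uE.
move: (Num.sqrt _ * _) (Num.sqrt ((1 + u) / 2)) w0 w1 h3 => a w w0 w1 a0 h2.
have : a * (1 - w) <= a * (1 - w) * (1 + w).
  by rewrite ler_peMr//; [rewrite mulr_ge0//; lra|lra].
by nra.
Qed.

Lemma cone_cap_sub_surface p r : @cone_cap R d p r `<=` conic_surface.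
Proof. by move=> q []. Qed.

Lemma conic_surface_sub_cap p r : (0 < d)%N -> conic_surface p -> 2 <= r ->
  conic_surface `<=` @cone_cap R d p r.
Proof.
move=> d0 cp r2 q cq.
have [xi xi1 pE] := conic_surface_polar d0 cp.
have [eta eta1 qE] := conic_surface_polar d0 cq.
rewrite (surjective_pairing p) (surjective_pairing q) pE qE.
apply/cone_capE => //; [by case: cp|by case: cq|].
apply: le_trans r2; apply: acos_le_pihalf; apply: cos_cone_dist_bounds.
- by case: cp.
- by case: cq.
- exact: dotp_unit_bounds.
Qed.

Lemma cone_cap_mono p r r' : r <= r' -> @cone_cap R d p r `<=` cone_cap p r'.
Proof. by move=> rr' q [cq qr]; split=> //; exact: le_trans rr'. Qed.

End conic_distance.

(** * Lebesgue measure of cubes in tuple space *)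

Section cubes.
Context {R : realType}.

Definition cube n (c : n.-tuple R) (a : R) : set (n.-tuple R) :=
  [set x | forall i, `|tnth x i - tnth c i| <= a].

Lemma measurable_cube n (c : n.-tuple R) a : measurable (cube c a).
Proof.
have -> : cube c a = \bigcap_(i in [set: 'I_n])
    ((@tnth n R ^~ i) @^-1` `[tnth c i - a, tnth c i + a]).
  apply/seteqP; split=> x /=.
    by move=> h i _ /=; rewrite in_itv/= -ler_distl; exact: h.
  by move=> h i; have := h i I; rewrite /= in_itv/= -ler_distl.
apply: fin_bigcap_measurable => //= i _.
rewrite -[X in measurable X]setTI.
by apply: measurable_tnth => //; exact: measurable_itv.
Qed.

Lemma lebesgue_tuple_cube n (c : n.-tuple R) (a : R) : 0 <= a ->
  lebesgue_tuple R n (cube c a) = ((2 * a) ^+ n)%:E.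
Proof.
move=> a0; elim: n c => [c|n ih c].
  rewrite /= diracE expr0 mem_set// => i; by case: i.
rewrite /= /lebesgue_cons /pushforward.
have -> : (fun p : R * n.-tuple R => [tuple of p.1 :: p.2]) @^-1` cube c a =
    `[tnth c ord0 - a, tnth c ord0 + a] `*` cube [tuple of behead c] a.
  apply/seteqP; split=> -[x y] /=.
    move=> h; split => /=.
      by have := h ord0; rewrite (tnth_nth 0)/= in_itv/= -ler_distl.
    move=> i; have := h (lift ord0 i).
    by rewrite !(tnth_nth 0)/= nth_behead.
  move=> [/= hx hy] i; case: (unliftP ord0 i) => [j ->|->].
    by have := hy j; rewrite !(tnth_nth 0)/= nth_behead.
  by move: hx; rewrite !(tnth_nth 0)/= in_itv/= -ler_distl.
rewrite product_measure1E//; last exact: measurable_cube.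
rewrite ih -[X in (X * _)%E = _]/(lebesgue_measure _).
rewrite lebesgue_measure_itv/= lte_fin exprS EFinM.
case: ifPn => [_|].
  by rewrite -EFinB; congr (_%:E * _)%E; ring.
rewrite -leNgt => h; have -> : a = 0 by lra.
by rewrite mulr0 !mul0e.
Qed.

End cubes.

(** * Surface measure of spherical caps, by covering and packing solid cones *)

Section spherical_caps.
Context {R : realType} {d : nat}.
Implicit Types xi eta x : d.-tuple R.

Definition spherical_cap xi (delta : R) : set (d.-tuple R) :=
  [set eta | enorm eta = 1 /\ 1 - dotp xi eta <= delta].

(** By the definition of [sphere_measure], [d] times the Lebesgue measure of this set is the surface
    measure of the spherical cap. *)
Definition solid_cap xi delta : set (d.-tuple R) :=
  normalize @^-1` spherical_cap xi delta `&` punctured_ball.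

Lemma measurable_spherical_cap xi delta : measurable (spherical_cap xi delta).
Proof.
have -> : spherical_cap xi delta =
    (@enorm R d @^-1` [set 1]) `&` (dotp xi @^-1` `[1 - delta, +oo[).
  apply/seteqP; split=> x /=; rewrite in_itv/= andbT => -[x1 h]; split => //; lra.
apply: measurableI; rewrite -[X in measurable X]setTI.
  by apply: measurable_enorm => //; exact: measurable_set1.
have : measurable_fun setT (@dotp R d xi).
  apply: measurable_sum => i; apply: measurable_funM; first exact: measurable_cst.
  exact: measurable_tnth.
by apply => //; exact: measurable_itv.
Qed.

Lemma measurable_solid_cap xi delta : measurable (solid_cap xi delta).
Proof.
apply: measurableI; last exact: measurable_punctured_ball.
rewrite -[X in measurable X]setTI; apply: measurable_normalize => //.
exact: measurable_spherical_cap.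
Qed.

Lemma tnth_unit_le1 xi i : enorm xi = 1 -> `|tnth xi i| <= 1.
Proof.
move=> xi1; have : dotp xi xi = 1 by rewrite -enorm_sqr xi1 expr1n.
rewrite /dotp (bigD1 i)//= => h.
rewrite -ler_sqr ?nnegrE// real_normK ?num_real// expr1n -h expr2 lerDl.
by apply: sumr_ge0 => j _; rewrite -expr2 sqr_ge0.
Qed.

Lemma tnth_normalize_cap xi delta x i (rho : R) : enorm xi = 1 -> 0 <= rho ->
  delta <= rho ^+ 2 -> solid_cap xi delta x ->
  `|tnth (normalize x) i - tnth xi i| <= 2 * rho.
Proof.
move=> xi1 rho0 drho [[/= n1 h] _].
have := sum_sqrB_unit n1 xi1; rewrite dotpC (bigD1 i)//= => hs.
rewrite -ler_sqr ?nnegrE ?mulr_ge0// real_normK ?num_real//.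
have : 0 <= \sum_(j < d | j != i) (tnth (normalize x) j - tnth xi j) ^+ 2.
  by apply: sumr_ge0 => j _; exact: sqr_ge0.
by have := sqr_ge0 rho; rewrite exprMn; lra.
Qed.

(** Rounding the norm of [x] down to a multiple of [rho] selects the cube. The rounding moves a
    coordinate by at most [rho], and replacing the direction of [x] by [xi] moves it by at most
    [2 * rho] as the norm is at most 1; hence the half-side [3 * rho]. *)
Lemma solid_cap_sub_cubes xi (rho : R) : enorm xi = 1 -> 0 < rho ->
  solid_cap xi (rho ^+ 2) `<=`
  \big[setU/set0]_(k < (Num.truncn rho^-1).+1) cube (tscale (k%:R * rho) xi) (3 * rho).
Proof.
move=> xi1 rho0 x cx.
rewrite -(bigcup_mkord _ (fun k => cube (tscale (k%:R * rho) xi) (3 * rho))).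
have [_ /= /andP[x0 x1]] := cx.
have ge0 : 0 <= enorm x / rho by rewrite divr_ge0// ltW.
have /andP[k1 k2] := truncn_itv ge0.
exists (Num.truncn (enorm x / rho)).
  rewrite /= ltnS truncn_le_nat// (le_lt_trans _ (truncnS_gt _))//.
  by rewrite ler_pdivrMr// mulVf ?gt_eqF.
move=> i; rewrite -{1}(tscale_normalize x0) (tnth_tscale (enorm x)) (tnth_tscale (_ * _)).
have h := tnth_normalize_cap i xi1 (ltW rho0) (lexx _) cx.
have hxi := tnth_unit_le1 i xi1.
set k := _%:R in k1 k2 *.
rewrite ler_pdivlMr// in k1.
rewrite -natr1 -/k ltr_pdivrMr// mulrDl mul1r in k2.
have -> : enorm x * tnth (normalize x) i - k * rho * tnth xi i =
  enorm x * (tnth (normalize x) i - tnth xi i) + (enorm x - k * rho) * tnth xi i by ring.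
apply: le_trans (ler_normD _ _) _; rewrite !normrM.
have -> : 3 * rho = 1 * (2 * rho) + rho * 1 by ring.
rewrite lerD// ler_pM//; first by rewrite ger0_norm// ltW.
by rewrite ger0_norm; lra.
Qed.

End spherical_caps.

Section spherical_cap_upper.
Context {R : realType} {d : nat}.
Implicit Types xi eta x : d.-tuple R.

Lemma lebesgue_solid_cap_le xi (rho : R) : enorm xi = 1 -> 0 < rho ->
  (lebesgue_tuple R d (solid_cap xi (rho ^+ 2))
   <= ((rho^-1 + 1) * (6 * rho) ^+ d)%:E)%E.
Proof.
move=> xi1 rho0.
have mc k : measurable (cube (tscale (k%:R * rho) xi) (3 * rho)).
  exact: measurable_cube.
apply: le_trans (content_subadditive (lebesgue_tuple R d) (fun k _ => mc k)
  (measurable_solid_cap xi (rho ^+ 2)) (solid_cap_sub_cubes xi1 rho0)) _.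
have rho3 : 0 <= 3 * rho by lra.
rewrite (eq_bigr (fun=> ((2 * (3 * rho)) ^+ d)%:E)); last first.
  by move=> k _; exact: lebesgue_tuple_cube.
rewrite sumEFin lee_fin sumr_const card_ord -(mulr_natl (_ ^+ _)).
have -> : 2 * (3 * rho) = 6 * rho by ring.
apply: ler_wpM2r; first by rewrite exprn_ge0// mulr_ge0// ltW.
rewrite -natr1 lerD2r.
by have /andP[] := truncn_itv (ltW (etrans (invr_gt0 rho) rho0)).
Qed.

Lemma sphere_measure_cap_le : (0 < d)%N -> exists2 C : R, 0 < C &
  forall xi (rho : R), enorm xi = 1 -> 0 < rho ->
  (sphere_measure (spherical_cap xi (rho ^+ 2)) <= (C * rho ^+ d.-1)%:E)%E.
Proof.
move=> d0; have dR0 : 0 < d%:R :> R by rewrite ltr0n.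
exists (d%:R * (2 * 12 ^+ d)); first by rewrite !mulr_gt0// exprn_gt0.
move=> xi rho xi1 rho0; rewrite -mulrA EFinM.
apply: lee_wpmul2l; first by rewrite lee_fin ltW.
have [rho1|rho1] := leP rho 1.
  apply: le_trans (lebesgue_solid_cap_le xi1 rho0) _; rewrite lee_fin.
  have -> : (6 * rho) ^+ d = 6 ^+ d * (rho * rho ^+ d.-1).
    by rewrite exprMn -exprS prednK.
  have -> : (rho^-1 + 1) * (6 ^+ d * (rho * rho ^+ d.-1)) =
     (1 + rho) * 6 ^+ d * rho ^+ d.-1 by field; rewrite gt_eqF.
  apply: ler_wpM2r; first by rewrite exprn_ge0// ltW.
  apply: ler_pM; rewrite ?exprn_ge0//; [lra|lra|].
  by apply: lerXn2r; rewrite ?nnegrE//; lra.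
(* For [rho > 1] the radius 2 already gives the whole sphere, because 1 - <xi,eta> <= 2, and the
   power of [rho] on the right is at least 1. *)
have le2 : solid_cap xi (rho ^+ 2) `<=` solid_cap xi (2 ^+ 2).
  move=> x [[/= x1 _] bx]; split=> //; split => //=.
  by have /andP[] := dotp_unit_bounds xi1 x1; lra.
apply: (@le_trans _ _ (lebesgue_tuple R d (solid_cap xi (2 ^+ 2)))).
  by apply: le_measure => //; rewrite inE; exact: measurable_solid_cap.
apply: le_trans (lebesgue_solid_cap_le xi1 _) _ => //; rewrite lee_fin.
have -> : 6 * 2 = 12 :> R by ring.
have rd1 : 1 <= rho ^+ d.-1 by rewrite exprn_ege1// ltW.
have : 0 < 12 ^+ d :> R by rewrite exprn_gt0.
move: (12 ^+ d) (rho ^+ d.-1) rd1 => a b b1 a0.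
have : 2 * a <= 2 * a * b by rewrite ler_peMr//; lra.
by move=> h; lra.
Qed.

End spherical_cap_upper.

Section spherical_cap_lower.
Context {R : realType} {d : nat}.
Hypothesis d0 : (0 < d)%N.
Implicit Types xi eta x : d.-tuple R.

Let dR0 : 0 < d%:R :> R. Proof. by rewrite ltr0n. Qed.
Let dR1 : 1 <= d%:R :> R. Proof. by rewrite ler1n. Qed.

(** Let e = x - c xi and n = |x|. Then n^2 - <xi,x>^2 = |e|^2 - <xi,e>^2: the displacement along the
    ray cancels, so the angular defect is quadratic in [rho]. The half-side makes |<xi,e>| and |e|
    at most rho/8; [c <= 7 / 8] then keeps x in the unit ball, and [2^-1 <= c] keeps n^2 above
    1/8. *)
Lemma cube_sub_solid_cap xi (rho c : R) : enorm xi = 1 -> 0 < rho <= 1 ->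
  2^-1 <= c <= 7 / 8 ->
  cube (tscale c xi) (rho / (8 * d%:R)) `<=` solid_cap xi (rho ^+ 2).
Proof.
move=> xi1 /andP[rho0 rho1] /andP[c12 c78] x cx.
set a := rho / (8 * d%:R) in cx.
have aE : a = rho / (8 * d%:R) by [].
pose e i := tnth x i - c * tnth xi i.
have ea i : `|e i| <= a by have := cx i; rewrite tnth_tscale.
have da : d%:R * a = rho / 8 by rewrite aE; field; rewrite gt_eqF.
have a0 : 0 <= a by rewrite divr_ge0// ?mulr_ge0 ?(ltW rho0)// ltW.
clearbody a.
have daa : d%:R * a ^+ 2 <= (rho / 8) ^+ 2.
  by rewrite -da exprMn; apply: ler_wpM2r; rewrite ?sqr_ge0// expr2 ler_peMr// ltW.
pose E1 := \sum_(i < d) tnth xi i * e i.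
pose E2 := \sum_(i < d) e i ^+ 2.
have xixi : dotp xi xi = 1 by rewrite -enorm_sqr xi1 expr1n.
have mE : dotp xi x = c + E1.
  rewrite -[c in RHS]mulr1 -xixi /dotp mulr_sumr -big_split/=.
  by apply: eq_bigr => i _; rewrite /e; ring.
have nE : dotp x x = c ^+ 2 + 2 * c * E1 + E2.
  rewrite -[c ^+ 2]mulr1 -[X in c ^+ 2 * X]xixi /dotp /E1 /E2 !mulr_sumr -!big_split/=.
  by apply: eq_bigr => i _; rewrite /e; ring.
have E1le : `|E1| <= rho / 8.
  apply: le_trans (ler_norm_sum _ _ _) _; rewrite -da mulr_natl.
  rewrite -[X in _ *+ X]card_ord -sumr_const; apply: ler_sum => i _.
  rewrite normrM -[leRHS]mul1r; apply: ler_pM => //.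
  exact: tnth_unit_le1.
have E2le : E2 <= (rho / 8) ^+ 2.
  apply: le_trans daa; rewrite mulr_natl -[X in _ *+ X]card_ord -sumr_const.
  apply: ler_sum => i _; rewrite -real_normK ?num_real//.
  by apply: lerXn2r; rewrite ?nnegrE.
have E20 : 0 <= E2 by apply: sumr_ge0 => i _; exact: sqr_ge0.
move: E1le; rewrite ler_norml => /andP[E1l E1u].
have n2 : enorm x ^+ 2 = c ^+ 2 + 2 * c * E1 + E2 by rewrite enorm_sqr.
have n18 : 1 / 8 <= enorm x ^+ 2 by rewrite n2 expr2; nra.
have n0 : 0 < enorm x.
  rewrite lt_neqAle enorm_ge0 andbT eq_sym; apply/eqP => n0.
  by move: n18; rewrite n0 expr2; lra.
have n1 : enorm x <= 1.
  rewrite -(@ler_pXn2r _ 2)// ?nnegrE ?enorm_ge0// expr1n n2.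
  by rewrite !expr2 in E2le *; nra.
split; last by rewrite /punctured_ball/= n0 n1.
split; first exact: enorm_normalize.
have -> : dotp xi (normalize x) = (enorm x)^-1 * (c + E1).
  by rewrite -{1}(tscale1 xi) dotpZ mul1r mE.
have n00 : enorm x != 0 by rewrite gt_eqF.
rewrite -(ler_pM2l n0) mulrBr mulr1 mulrA mulfV// mul1r.
have m0 : 0 < c + E1 by lra.
rewrite -(@ler_pM2r _ (enorm x + (c + E1))); last by rewrite addr_gt0.
have -> : (enorm x - (c + E1)) * (enorm x + (c + E1)) = E2 - E1 ^+ 2.
  by rewrite -subr_sqr n2; ring.
have : (rho / 8) ^+ 2 <= enorm x ^+ 2 * rho ^+ 2.
  by have := sqr_ge0 rho; rewrite expr_div_n; nra.
have : 0 <= enorm x * rho ^+ 2 * (c + E1).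
  by rewrite !mulr_ge0// ?sqr_ge0// ltW.
by have := sqr_ge0 E1; rewrite [enorm x ^+ 2]expr2; lra.
Qed.

(** All coordinates of [xi] may be small, so no single one separates two cubes. A common point would
    bound every coordinate of the difference of centres by [2 * a]; summing squares gives (rho/2)^2
    <= (rho/2)^2 / (4 d), which is absurd. *)
Lemma trivIset_ray_cubes xi (rho : R) : enorm xi = 1 -> 0 < rho ->
  trivIset setT (fun k : nat =>
    cube (tscale (2^-1 + k%:R * (rho / 2)) xi) (rho / (8 * d%:R))).
Proof.
move=> xi1 rho0; apply/trivIsetP => j k _ _ jk; apply/seteqP; split=> // x [cj ck].
have xixi : dotp xi xi = 1 by rewrite -enorm_sqr xi1 expr1n.
set a := rho / (8 * d%:R) in cj ck.
have aE : a = rho / (8 * d%:R) by [].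
have a0 : 0 <= a by rewrite divr_ge0// ?mulr_ge0 ?(ltW rho0)// ltW.
clearbody a.
have jk1 : 1 <= (j%:R - k%:R) ^+ 2 :> R.
  have : 1 <= `|(j%:Z - k%:Z)%:~R| :> R.
    by rewrite -intr_norm ler1z -gtz0_ge1 normr_gt0 subr_eq0.
  by rewrite intrB => h; rewrite -[leRHS]real_normK ?num_real//; exact: exprn_ege1.
have hi i : (rho / 2) ^+ 2 * (tnth xi i * tnth xi i) <= 4 * a ^+ 2.
  have h : `|(j%:R - k%:R) * (rho / 2) * tnth xi i| <= 2 * a.
    have -> : (j%:R - k%:R) * (rho / 2) * tnth xi i =
      (tnth x i - (2^-1 + k%:R * (rho / 2)) * tnth xi i)
      - (tnth x i - (2^-1 + j%:R * (rho / 2)) * tnth xi i) by ring.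
    apply: le_trans (ler_normB _ _) _.
    by have := cj i; have := ck i; rewrite !tnth_tscale; lra.
  have {}h : ((j%:R - k%:R) * (rho / 2) * tnth xi i) ^+ 2 <= (2 * a) ^+ 2.
    rewrite -real_normK ?num_real//.
    by apply: lerXn2r h; rewrite ?nnegrE// mulr_ge0.
  rewrite (_ : 4 * a ^+ 2 = (2 * a) ^+ 2); last by ring.
  apply: le_trans h; rewrite -expr2 -exprMn -mulrA [leRHS]exprMn ler_peMl//.
  by rewrite sqr_ge0.
have : (rho / 2) ^+ 2 <= d%:R * (4 * a ^+ 2).
  have -> : (rho / 2) ^+ 2 = (rho / 2) ^+ 2 * dotp xi xi by rewrite xixi mulr1.
  rewrite /dotp mulr_sumr mulr_natl -[X in _ <= _ *+ X]card_ord.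
  by rewrite -sumr_const; apply: ler_sum => i _; exact: hi.
have -> : d%:R * (4 * a ^+ 2) = (rho / 2) ^+ 2 / 4 / d%:R.
  by rewrite aE; field; rewrite gt_eqF.
rewrite ler_pdivlMr//; have : 0 < (rho / 2) ^+ 2 by rewrite exprn_gt0// divr_gt0.
move: ((rho / 2) ^+ 2) => b b0; suff : b <= b * d%:R by move=> h1 h2; exfalso; lra.
by rewrite ler_peMr// ltW.
Qed.

Lemma sphere_measure_cap_ge : exists2 c : R, 0 < c &
  forall xi (rho : R), enorm xi = 1 -> 0 < rho <= 1 ->
  ((c * rho ^+ d.-1)%:E <= sphere_measure (spherical_cap xi (rho ^+ 2)))%E.
Proof.
exists (3 / 4 * (4 * d%:R)^-1 ^+ d).
  by rewrite !mulr_gt0// exprn_gt0// invr_gt0 mulr_gt0.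
move=> xi rho xi1 /andP[rho0 rho1].
set a := rho / (8 * d%:R).
have aE : a = rho / (8 * d%:R) by [].
have a0 : 0 <= a by rewrite divr_ge0// ?mulr_ge0 ?(ltW rho0)// ltW.
pose F k := cube (tscale (2^-1 + k%:R * (rho / 2)) xi) a.
have mF k : measurable (F k) by exact: measurable_cube.
(* The centre 1/2 + k rho/2 stays below 7/8 exactly when k <= 3/(4 rho). *)
pose N := (Num.truncn (3 / (4 * rho))).+1.
have q0 : 0 <= 3 / (4 * rho) by rewrite divr_ge0// mulr_ge0// ltW.
have /andP[N1 N2] := truncn_itv q0.
have sF : \big[setU/set0]_(k < N) F k `<=` solid_cap xi (rho ^+ 2).
  rewrite -bigcup_mkord => x [k/= kN]; apply: cube_sub_solid_cap => //.
    by rewrite rho0.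
  have k0 : 0 <= k%:R * (rho / 2) by rewrite mulr_ge0// divr_ge0// ltW.
  have : k%:R <= 3 / (4 * rho).
    by apply: le_trans N1; rewrite ler_nat -ltnS.
  rewrite ler_pdivlMr ?mulr_gt0// => k1.
  by apply/andP; split; lra.
apply: (@le_trans _ _ (lebesgue_tuple R d (solid_cap xi (rho ^+ 2)))); last first.
  rewrite -[leLHS]mul1e; apply: lee_wpmul2r; first exact: measure_ge0.
  by rewrite lee_fin.
apply: (@le_trans _ _ (lebesgue_tuple R d (\big[setU/set0]_(k < N) F k))); last first.
  apply: le_measure => //; rewrite inE; first exact: bigsetU_measurable.
  exact: measurable_solid_cap.
rewrite (measure_bigsetU (lebesgue_tuple R d) mF); last exact: trivIset_ray_cubes.
rewrite (eq_bigr (fun=> ((2 * a) ^+ d)%:E)); last first.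
  by move=> k _; exact: lebesgue_tuple_cube.
rewrite sumEFin lee_fin sumr_const card_ord -(mulr_natl (_ ^+ _)).
apply: (@le_trans _ _ (3 / (4 * rho) * (2 * a) ^+ d)); last first.
  by apply: ler_wpM2r; [rewrite exprn_ge0// mulr_ge0|exact: ltW].
have -> : 2 * a = (4 * d%:R)^-1 * rho by rewrite aE; field; rewrite gt_eqF.
have -> : ((4 * d%:R)^-1 * rho) ^+ d = (4 * d%:R)^-1 ^+ d * (rho * rho ^+ d.-1).
  by rewrite exprMn -exprS prednK.
move: (_ ^+ d) (rho ^+ d.-1) => u v.
rewrite le_eqVlt; apply/orP; left; apply/eqP; field.
by rewrite gt_eqF.
Qed.

End spherical_cap_lower.

(** * A comparison principle for integrals of nonnegative functions *)

Section integral_monotone.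
Context {R : realType} {disp : measure_display} {T : measurableType disp}.
Variable mu : {measure set T -> \bar R}.
Local Open Scope ereal_scope.

(* The integral of a nonnegative function is a supremum over simple functions
   below it, so no measurability is needed. *)
Lemma ge0_le_integral_dom (A B : set T) (f g : T -> \bar R) :
  (forall x, A x -> 0 <= f x) -> (forall x, B x -> 0 <= g x) ->
  (forall x, A x -> B x -> f x <= g x) -> (forall x, A x -> ~ B x -> f x = 0) ->
  \int[mu]_(x in A) f x <= \int[mu]_(x in B) g x.
Proof.
move=> f0 g0 fg fB; rewrite [leLHS]integral_mkcond [leRHS]integral_mkcond.
rewrite !ge0_integralTE; last 2 first.
- by move=> x; rewrite patchE; case: ifPn => // /set_mem/g0.
- by move=> x; rewrite patchE; case: ifPn => // /set_mem/f0.
apply: le_ereal_sup => _ [h /= hf <-]; exists h => //= x.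
apply: le_trans (hf x) _; rewrite !patchE.
have [/set_mem Ax|_] := boolP (x \in A);
  have [/set_mem Bx|/negP nB] := boolP (x \in B) => //.
- exact: fg.
- by rewrite fB// => Bx; apply: nB; rewrite inE.
- exact: g0.
Qed.

End integral_monotone.

(** * Integrals of powers of a level function [v], later [s] or [1 - s] *)

Section power_integral.
Context {R : realType}.
Variable v : R -> R.
Hypothesis mv : measurable_fun setT v.
Hypothesis lv : forall a b : R, a <= b ->
  (lebesgue_measure (v @^-1` `[a, b]) <= (b - a)%:E)%E.
Let mu := @lebesgue_measure R.

Let mvI (a b : R) : measurable (v @^-1` `[a, b]).
Proof.
by rewrite -[X in measurable X]setTI; apply: mv => //; exact: measurable_itv.
Qed.

Lemma exists_dyadic (a x : R) : 0 < x <= a ->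
  exists n, 2^-1 ^+ n.+1 * a < x <= 2^-1 ^+ n * a.
Proof.
move=> /andP[x0 xa]; have a0 : 0 < a by exact: lt_le_trans xa.
have ex : exists n, 2^-1 ^+ n.+1 * a < x.
  exists (Num.truncn (a / x)).
  rewrite exprVn mulrC ltr_pdivrMr ?exprn_gt0// -ltr_pdivrMl// mulrC.
  apply: lt_trans (truncnS_gt _) _; rewrite -natrX ltr_nat.
  exact: ltn_expl.
exists (ex_minn ex); case: ex_minnP => n hn nmin; rewrite hn/=.
case: n hn nmin => [_ _|n hn nmin]; first by rewrite expr0 mul1r.
by rewrite leNgt; apply/negP => /nmin; rewrite ltnn.
Qed.

Lemma powR_le_dyadic (p a x : R) n : 0 < a ->
  2^-1 ^+ n.+1 * a < x <= 2^-1 ^+ n * a ->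
  x `^ p <= 2 `^ `|p| * (2^-1 ^+ n * a) `^ p.
Proof.
move=> a0 /andP[h1 h2]; have n0 : 0 < 2^-1 ^+ n * a by rewrite mulr_gt0// exprn_gt0.
rewrite exprS -mulrA in h1; have x0 : 0 < x by lra.
by apply: powR_le_comparable => //; lra.
Qed.

Lemma geometric_sum_le (q : R) n : 0 <= q < 1 -> \sum_(i < n) q ^+ i <= (1 - q)^-1.
Proof.
move=> /andP[q0 q1]; rewrite -[(1 - q)^-1]mul1r ler_pdivlMr ?subr_gt0//.
have -> : (\sum_(i < n) q ^+ i) * (1 - q) = 1 - q ^+ n.
  by rewrite -[1 - q ^+ n]opprB subrX1; ring.
by have := exprn_ge0 n q0; lra.
Qed.

(** On the dyadic shell below x_n = a/2^n the power is comparable to its value at x_n. Each shell is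
    enlarged to the full preimage of [0, x_n]; its measure is still at most x_n, so the sum is
    geometric with ratio 2^-(p+1), below 1 because p > -1. *)
Lemma integral_powR_le (p : R) : -1 < p -> exists2 C : R, 0 < C &
  forall a : R, 0 < a ->
  (\int[mu]_(s in v @^-1` `[0%R, a]) (v s `^ p)%:E <= (C * a `^ (p + 1))%:E)%E.
Proof.
move=> p1; have p10 : 0 < p + 1 by lra.
pose q : R := 2^-1 `^ (p + 1).
have q0 : 0 < q by exact: powR_gt0.
have q1 : q < 1.
  have -> : 1 = 1 `^ (p + 1) :> R by rewrite powR1.
  by apply: gt0_ltr_powR => //; rewrite ?nnegrE//; lra.
have l0 : 0 < 2 `^ `|p| :> R by exact: powR_gt0.
exists (2 `^ `|p| * (1 - q)^-1); first by rewrite mulr_gt0// invr_gt0 subr_gt0.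
move=> a a0; pose x n := 2^-1 ^+ n * a.
have x0 n : 0 < x n by rewrite mulr_gt0// exprn_gt0.
pose c n := 2 `^ `|p| * (x n) `^ p.
have c0 n : 0 <= c n by rewrite mulr_ge0// ?powR_ge0// ltW.
pose G n : set (measurableTypeR R) := v @^-1` `[0, x n].
have mA : measurable (v @^-1` `[0, a] : set (measurableTypeR R)) by exact: mvI.
have mG n : measurable (G n) by exact: mvI.
pose f n (s : measurableTypeR R) : \bar R := ((c n)%:E * (\1_(G n) s)%:E)%E.
have f0 n s : (0 <= f n s)%E by rewrite mule_ge0// lee_fin.
have mf n D : measurable_fun D (f n).
  apply: emeasurable_funM; first exact: measurable_cst.
  by apply/measurable_EFinP; apply: measurable_indic; exact: mG.
apply: (@le_trans _ _ (\int[mu]_(s in v @^-1` `[0%R, a]) (\sum_(n <oo) f n s))%E).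
  apply: ge0_le_integral_dom => // s.
  - by move=> _; rewrite lee_fin powR_ge0.
  - by move=> _; apply: nneseries_ge0.
  - rewrite /= in_itv/= => /andP[vs0 vsa] _.
    have [n hn] : exists n, ((v s `^ p)%:E <= f n s)%E.
      move: vs0; rewrite le_eqVlt => /predU1P[vs0|vs0].
        (* No dyadic shell contains the value 0. Its power is 0 by convention, except that it is 1
           when [p = 0]; the term of index 0 dominates both. *)
        exists 0%N; rewrite /f indicE mem_set; last first.
          by rewrite /G/= in_itv/= -vs0 lexx ltW.
        rewrite mule1 lee_fin -vs0 /powR eqxx; case: eqVneq => // p0.
        by rewrite /c p0 normr0 !powRr0 mulr1.
      have [n hn] := @exists_dyadic a (v s) (introT andP (conj vs0 vsa)).
      exists n; rewrite /f indicE mem_set; last first.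
        by rewrite /G/= in_itv/= ltW//; case/andP: hn.
      by rewrite mule1 lee_fin; exact: powR_le_dyadic.
    apply: le_trans hn _; rewrite (nneseriesD1 (n := n))//.
    by rewrite leeDl// nneseries_ge0.
rewrite integral_nneseries//.
apply: lime_le; first by apply: is_cvg_nneseries => k _ _; exact: integral_ge0.
apply: nearW => n; rewrite big_mkord.
apply: (@le_trans _ _ (\sum_(i < n) (2 `^ `|p| * a `^ (p + 1) * q ^+ i)%:E)%E).
  apply: lee_sum => i _; rewrite /f ge0_integralZl_EFin//; last first.
    by apply/measurable_EFinP; apply: measurable_indic; exact: mG.
  rewrite integral_indic//.
  apply: (@le_trans _ _ ((c i)%:E * (x i)%:E)%E).
    apply: lee_wpmul2l; first by rewrite lee_fin.
    apply: (@le_trans _ _ (mu (G i))).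
      by apply: le_measure;
        [apply/mem_set; exact: measurableI|apply/mem_set; exact: mG|exact: subIsetl].
    by apply: le_trans (lv (ltW (x0 i))) _; rewrite subr0.
  rewrite -EFinM lee_fin /c -!mulrA ler_pM2l//.
  have -> : x i `^ p * x i = x i `^ (p + 1).
    by rewrite powRD ?powRr1 ?(ltW (x0 i))// (gt_eqF (x0 i)) implybT.
  rewrite /x powRM ?exprn_ge0//; last exact: ltW.
  have h2 : 0 <= 2^-1 :> R by [].
  by rewrite -(powR_mulrn i h2) powRAC powR_mulrn ?powR_ge0// mulrC.
rewrite sumEFin lee_fin -mulr_sumr [leRHS]mulrAC.
apply: ler_wpM2l; first by rewrite mulr_ge0// ?powR_ge0// ltW.
by apply: geometric_sum_le; rewrite q1 ltW.
Qed.

Lemma sqrt_near_bounds (t x r : R) : 0 <= x -> 0 <= t ->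
  `|Num.sqrt x - Num.sqrt t| <= r ->
  Num.sqrt x <= Num.sqrt t + r /\
  `|x - t| <= r * (2 * Num.sqrt t + r).
Proof.
move=> x0 t0 h; have := h; rewrite ler_norml => /andP[h1 h2].
have r0 : 0 <= r by exact: le_trans h.
split; first by lra.
have -> : x - t = (Num.sqrt x - Num.sqrt t) * (Num.sqrt x + Num.sqrt t).
  by rewrite -subr_sqr !sqr_sqrtr.
rewrite normrM [X in _ * X]ger0_norm ?addr_ge0 ?sqrtr_ge0//.
by apply: ler_pM; rewrite ?addr_ge0 ?sqrtr_ge0//; lra.
Qed.

(** Away from the singular level, 2 r <= sqrt t, so sqrt v lies between half and three halves of
    sqrt t: the integrand is nearly constant. Moreover |v - t| <= r (2 sqrt t + r) <= (5/2) r sqrt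
    t, an interval of length 5 r sqrt t. The factor [M] stays inside the integral so that callers
    can compare integrands directly. *)
Lemma integral_powR_near_large (p : R) : exists2 C : R, 0 < C &
  forall t r M : R, 0 < r -> 4 * r ^+ 2 <= t -> 0 <= M ->
  (\int[mu]_(s in [set s | (0 <= v s)%R /\
       (`|Num.sqrt (v s) - Num.sqrt t| <= r)%R]) (M * v s `^ p)%:E
   <= (M * (C * (r * (t + r ^+ 2) `^ (p + 2^-1))))%:E)%E.
Proof.
exists (5 * 4 `^ `|p| * 2 `^ `|p + 2^-1|); first by rewrite !mulr_gt0// powR_gt0.
move=> t r M r0 rt M0.
have r20 : 0 < r ^+ 2 by rewrite exprn_gt0.
have t0 : 0 < t by lra.
have sr : 2 * r <= Num.sqrt t.
  rewrite -(@ler_pXn2r _ 2)// ?nnegrE ?sqrtr_ge0//; last by lra.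
  by rewrite sqr_sqrtr ?(ltW t0)// exprMn; lra.
have [k k0 kE] : exists2 k : R, 0 <= k & k = 5 / 2 * (r * Num.sqrt t).
  by eexists; last reflexivity; rewrite mulr_ge0// mulr_ge0// ?sqrtr_ge0// ltW.
have mA : measurable (v @^-1` `[t - k, t + k] : set (measurableTypeR R)).
  exact: mvI.
apply: (@le_trans _ _ (\int[mu]_(s in v @^-1` `[(t - k)%R, (t + k)%R])
    (cst (M * (4 `^ `|p| * t `^ p))%:E s))%E).
  apply: ge0_le_integral_dom => s /=.
  - by move=> _; rewrite lee_fin mulr_ge0// powR_ge0.
  - by move=> _; rewrite lee_fin !mulr_ge0// powR_ge0.
  - move=> [v0 h] _; rewrite lee_fin; apply: ler_wpM2l => //.
    have := h; rewrite ler_norml => /andP[h1 h2].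
    have v1 : v s = Num.sqrt (v s) ^+ 2 by rewrite sqr_sqrtr.
    have t1 : t = Num.sqrt t ^+ 2 by rewrite sqr_sqrtr ?(ltW t0).
    have vp : 0 < v s by rewrite v1 exprn_gt0//; lra.
    apply: powR_le_comparable => //; first by lra.
      by rewrite v1 [in leRHS]t1 !expr2; nra.
    by rewrite v1 [in leLHS]t1 !expr2; nra.
  - move=> [v0 h] nB; exfalso; apply: nB; rewrite in_itv/= -ler_distl.
    have [_ h'] := sqrt_near_bounds v0 (ltW t0) h.
    apply: le_trans h' _; rewrite kE mulrCA; apply: ler_wpM2l; first exact: ltW.
    by lra.
rewrite integral_cst//.
apply: (@le_trans _ _ ((M * (4 `^ `|p| * t `^ p))%:E * (2 * k)%:E)%E).
  apply: lee_wpmul2l; first by rewrite lee_fin !mulr_ge0// powR_ge0.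
  have ktk : t - k <= t + k by lra.
  by apply: le_trans (lv ktk) _; rewrite lee_fin; lra.
rewrite -EFinM lee_fin -!mulrA; apply: ler_wpM2l => //.
have -> : 4 `^ `|p| * (t `^ p * (2 * k)) = 5 * (4 `^ `|p| * (r * t `^ (p + 2^-1))).
  by rewrite powRD ?(gt_eqF t0) ?implybT// powR12_sqrt ?(ltW t0)// kE; field.
rewrite ler_pM2l// ler_pM2l ?powR_gt0// [leRHS]mulrCA ler_pM2l//.
by apply: powR_le_comparable => //; lra.
Qed.

(** When t < 4 r^2, sqrt v <= sqrt t + r <= 3 r, so everything happens in [0, 9 r^2] and
    [integral_powR_le] applies. It yields a multiple of r (r^2)^(p + 1/2), and t + r^2 lies between
    r^2 and 5 r^2. *)
Lemma integral_powR_near (p : R) : -1 < p -> exists2 C : R, 0 < C &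
  forall t r M : R, 0 <= t -> 0 < r -> 0 <= M ->
  (\int[mu]_(s in [set s | (0 <= v s)%R /\
       (`|Num.sqrt (v s) - Num.sqrt t| <= r)%R]) (M * v s `^ p)%:E
   <= (M * (C * (r * (t + r ^+ 2) `^ (p + 2^-1))))%:E)%E.
Proof.
move=> p1; have [C1 C10 h1] := integral_powR_near_large p.
have [C2 C20 h2] := integral_powR_le p1.
pose C3 := C2 * (9 `^ (p + 1) * 5 `^ `|p + 2^-1|).
have C30 : 0 < C3 by rewrite !mulr_gt0// powR_gt0.
exists (C1 + C3); first by rewrite addr_gt0.
move=> t r M t0 r0 M0.
have r20 : 0 < r ^+ 2 by rewrite exprn_gt0.
have X0 : 0 <= r * (t + r ^+ 2) `^ (p + 2^-1) by rewrite mulr_ge0 ?powR_ge0// ltW.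
have [rt|rt] := leP (4 * r ^+ 2) t.
  apply: le_trans (h1 t r M r0 rt M0) _; rewrite lee_fin.
  by apply: ler_wpM2l => //; apply: ler_wpM2r => //; lra.
have st : Num.sqrt t <= 2 * r.
  rewrite -(@ler_pXn2r _ 2)// ?nnegrE ?sqrtr_ge0//; last by lra.
  by rewrite sqr_sqrtr// exprMn; lra.
have r9 : 0 < 9 * r ^+ 2 by lra.
have mA : measurable (v @^-1` `[0, 9 * r ^+ 2] : set (measurableTypeR R)).
  exact: mvI.
apply: (@le_trans _ _ (\int[mu]_(s in v @^-1` `[0%R, (9 * r ^+ 2)%R])
    (M%:E * (v s `^ p)%:E))%E).
  apply: ge0_le_integral_dom => s /=.
  - by move=> _; rewrite lee_fin mulr_ge0// powR_ge0.
  - by move=> _; rewrite lee_fin !mulr_ge0// powR_ge0.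
  - by [].
  - move=> [v0 h] nB; exfalso; apply: nB; rewrite in_itv/= v0/=.
    have [h' _] := sqrt_near_bounds v0 t0 h.
    have -> : 9 * r ^+ 2 = (3 * r) ^+ 2 by ring.
    rewrite -[v s]sqr_sqrtr//; apply: lerXn2r; rewrite ?nnegrE ?sqrtr_ge0//; lra.
rewrite ge0_integralZl_EFin//; last 2 first.
- by move=> s _; rewrite lee_fin powR_ge0.
- apply/measurable_EFinP/measurable_funTS.
  exact: (measurableT_comp (measurable_powR p) mv).
apply: (@le_trans _ _ (M%:E * (C2 * (9 * r ^+ 2) `^ (p + 1))%:E)%E).
  by apply: lee_wpmul2l; rewrite ?lee_fin//; exact: h2.
rewrite -EFinM lee_fin; apply: ler_wpM2l => //.
apply: (@le_trans _ _ (C3 * (r * (t + r ^+ 2) `^ (p + 2^-1)))); last first.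
  by apply: ler_wpM2r => //; lra.
rewrite /C3 -!mulrA ler_pM2l// powRM// ?(ltW r20)// ler_pM2l ?powR_gt0//.
have -> : (r ^+ 2) `^ (p + 1) = r * (r ^+ 2) `^ (p + 2^-1).
  have -> : p + 1 = (p + 2^-1) + 2^-1 by field.
  rewrite powRD ?(gt_eqF r20) ?implybT// [X in _ * X]powR12_sqrt ?(ltW r20)//.
  by rewrite sqrtr_sqr ger0_norm ?(ltW r0)// mulrC.
rewrite [leRHS]mulrCA ler_pM2l//.
by apply: powR_le_comparable => //; lra.
Qed.

End power_integral.

Section reflected_level.
Context {R : realType}.

Lemma lebesgue_preimage_id_le (a b : R) : a <= b ->
  (lebesgue_measure ((@id R) @^-1` `[a, b]) <= (b - a)%:E)%E.
Proof.
rewrite preimage_id lebesgue_measure_itv/= lte_fin => ab.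
by case: ifPn => // _; rewrite lee_fin subr_ge0.
Qed.

Lemma lebesgue_preimage_onem_le (a b : R) : a <= b ->
  (lebesgue_measure ((fun s : R => (1 - s)%R) @^-1` `[a, b]) <= (b - a)%:E)%E.
Proof.
have -> : (fun s : R => (1 - s)%R) @^-1` `[a, b] = `[1 - b, 1 - a]%classic.
  by apply/seteqP; split=> s /=; rewrite !in_itv/= => /andP[? ?]; apply/andP; split; lra.
rewrite lebesgue_measure_itv/= lte_fin => ab.
case: ifPn => [_|_]; last by rewrite lee_fin subr_ge0.
by rewrite -EFinB lee_fin; lra.
Qed.

Lemma measurable_onem_fun : measurable_fun setT (fun s : R => 1 - s).
Proof. by apply: measurable_funB; [exact: measurable_cst|exact: measurable_id]. Qed.

End reflected_level.

(** * The radial density of the Jacobi weight and the slices of a cap *)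

Section jacobi_density.
Context {R : realType} {d : nat}.
Hypothesis d2 : (2 <= d)%N.
Variables beta gamma : R.
Implicit Types (xi eta : d.-tuple R) (t s r : R).

(** The weight and the surface element together; it exceeds -1 exactly when beta > -d. *)
Definition radial_exponent : R := beta + d%:R - 1.

Definition radial_density s : R := s `^ beta * (1 - s) `^ gamma * s ^+ d.-1.

Lemma radial_density_ge0 s : 0 <= s -> 0 <= radial_density s.
Proof. by move=> s0; rewrite !mulr_ge0 ?powR_ge0// exprn_ge0. Qed.

Lemma radial_densityE s : 0 < s ->
  radial_density s = s `^ radial_exponent * (1 - s) `^ gamma.
Proof.
move=> s0; rewrite /radial_density mulrAC; congr (_ * _).
rewrite -powR_mulrn ?(ltW s0)// -powRD ?(gt_eqF s0) ?implybT//.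
congr (_ `^ _); rewrite /radial_exponent -addrA; congr (_ + _).
by case: d d2 => // n _; rewrite -natr1 addrK.
Qed.

(** At [s = 0] equality may fail: the left side vanishes because d >= 2, while the power of 0 on the
    right is 1 when [radial_exponent] is 0. *)
Lemma radial_density_le s : 0 <= s ->
  radial_density s <= s `^ radial_exponent * (1 - s) `^ gamma.
Proof.
rewrite le_eqVlt => /predU1P[<-|s0]; last by rewrite radial_densityE.
rewrite /radial_density expr0n; case: d d2 => [//|[//|n]] _ /=.
by rewrite mulr0 mulr_ge0 ?powR_ge0.
Qed.

Definition sphere_slice (E : set (d.-tuple R * R)) s : set (d.-tuple R) :=
  unit_sphere `&` [set eta | E (tscale s eta, s)].

Lemma weight_mass_jacobiE E : weight_mass (jacobi_weight beta gamma) E =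
  (\int[lebesgue_measure]_(s in `[0%R, 1%R])
     \int[@sphere_measure R d]_(eta in sphere_slice E s) (radial_density s)%:E)%E.
Proof. by []. Qed.

Lemma weight_mass_ge0 E : (0 <= weight_mass (@jacobi_weight R d beta gamma) E)%E.
Proof.
rewrite weight_mass_jacobiE; apply: integral_ge0 => s /=; rewrite in_itv/= => /andP[s0 _].
by apply: integral_ge0 => eta _; rewrite lee_fin radial_density_ge0.
Qed.

Lemma weight_mass_mono E E' : E `<=` E' ->
  (weight_mass (@jacobi_weight R d beta gamma) E
   <= weight_mass (jacobi_weight beta gamma) E')%E.
Proof.
move=> EE'; rewrite !weight_mass_jacobiE.
have h (s : R) : 0 <= s ->
    (0 <= \int[@sphere_measure R d]_(eta in sphere_slice E s) (radial_density s)%:E)%E.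
  by move=> s0; apply: integral_ge0 => eta _; rewrite lee_fin radial_density_ge0.
have h' (s : R) : 0 <= s ->
    (0 <= \int[@sphere_measure R d]_(eta in sphere_slice E' s) (radial_density s)%:E)%E.
  by move=> s0; apply: integral_ge0 => eta _; rewrite lee_fin radial_density_ge0.
apply: ge0_le_integral_dom => s /=; rewrite in_itv/=.
- by move=> /andP[s0 _]; exact: h.
- by move=> /andP[s0 _]; exact: h'.
- move=> /andP[s0 _] _; apply: ge0_le_integral_dom => eta //.
  + by move=> _; rewrite lee_fin radial_density_ge0.
  + by move=> _; rewrite lee_fin radial_density_ge0.
  + by move=> [? ?] []; split=> //; exact: EE'.
- by [].
Qed.

Lemma slice_integral_le E s (S : set (d.-tuple R)) (sigma : R) : 0 <= s ->
  measurable S -> sphere_slice E s `<=` S -> (sphere_measure S <= sigma%:E)%E ->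
  (\int[@sphere_measure R d]_(eta in sphere_slice E s) (radial_density s)%:E
   <= (radial_density s * sigma)%:E)%E.
Proof.
move=> s0 mS ES Ss; have ds := radial_density_ge0 s0.
apply: (@le_trans _ _ (\int[@sphere_measure R d]_(eta in S)
    (cst (radial_density s)%:E eta))%E).
  by apply: ge0_le_integral_dom => // x; move=> /ES.
by rewrite integral_cst// (EFinM (radial_density s) sigma); apply: lee_wpmul2l.
Qed.

Lemma slice_integral_ge E s (S : set (d.-tuple R)) (sigma : R) : 0 <= s ->
  measurable S -> S `<=` sphere_slice E s -> (sigma%:E <= sphere_measure S)%E ->
  ((radial_density s * sigma)%:E <=
   \int[@sphere_measure R d]_(eta in sphere_slice E s) (radial_density s)%:E)%E.
Proof.
move=> s0 mS ES Ss; have ds := radial_density_ge0 s0.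
apply: (@le_trans _ _ (\int[@sphere_measure R d]_(eta in S)
    (cst (radial_density s)%:E eta))%E).
  by rewrite integral_cst// (EFinM (radial_density s) sigma); apply: lee_wpmul2l.
by apply: ge0_le_integral_dom => // x; move=> /ES.
Qed.

(** If t < 4 r^2 then T < 5 r^2 and the squared radius exceeds 16/5 > 2, so the target is the whole
    sphere. Otherwise sqrt s >= sqrt t / 2, whence 1 - <xi,eta> <= 4 r^2 / t, and T <= 5t/4. *)
Lemma cap_slice_sub t xi r s : 0 <= t <= 1 -> enorm xi = 1 -> 0 < r <= 1 ->
  0 <= s <= 1 ->
  sphere_slice (cone_cap (tscale t xi, t) r) s `<=`
  spherical_cap xi ((4 * (r / Num.sqrt (t + r ^+ 2))) ^+ 2).
Proof.
move=> t01 xi1 /andP[r0 r1] s01 eta [/= eta1 /(cone_capE r t01 s01 xi1 eta1)].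
have u1 := dotp_unit_bounds xi1 eta1.
move=> /(cone_dist_le t01 s01 u1) []; first by rewrite r1 ltW.
move=> h1 _ h3; split => //.
move: u1 h3; move: (dotp xi eta) => u /andP[u0 u1] h3.
have /andP[t0 _] := t01.
have r20 : 0 < r ^+ 2 by rewrite exprn_gt0.
have T0 : 0 < t + r ^+ 2 by lra.
rewrite exprMn expr_div_n sqr_sqrtr ?(ltW T0)// mulrA ler_pdivlMr//.
have [rt|rt] := leP (4 * r ^+ 2) t; last by nra.
have sr : 2 * r <= Num.sqrt t.
  rewrite -(@ler_pXn2r _ 2)// ?nnegrE ?sqrtr_ge0//; last by lra.
  by rewrite sqr_sqrtr// exprMn; lra.
have tE : t = Num.sqrt t ^+ 2 by rewrite sqr_sqrtr.
move: h1; rewrite ler_norml => /andP[h1 h2].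
have : Num.sqrt t * Num.sqrt s >= t / 2.
  rewrite [in X in X / 2]tE expr2.
  have : Num.sqrt t / 2 <= Num.sqrt s by lra.
  by have := sqrtr_ge0 t; nra.
by move: (Num.sqrt t * Num.sqrt s) h3 => a; nra.
Qed.

Lemma cap_slice_empty t xi r s : 0 <= t <= 1 -> enorm xi = 1 -> 0 < r <= 1 ->
  0 <= s <= 1 ->
  ~ (`|Num.sqrt s - Num.sqrt t| <= r /\ `|Num.sqrt (1 - s) - Num.sqrt (1 - t)| <= r) ->
  sphere_slice (cone_cap (tscale t xi, t) r) s = set0.
Proof.
move=> t01 xi1 /andP[r0 r1] s01 n; apply/seteqP; split=> // eta.
move=> [/= eta1 /(cone_capE r t01 s01 xi1 eta1)].
move=> /(cone_dist_le t01 s01 (dotp_unit_bounds xi1 eta1)) []; first by rewrite r1 ltW.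
by move=> h1 h2 _; apply: n; rewrite distrC h1 distrC.
Qed.

End jacobi_density.

(** * Upper bound for the mass of a small cap *)

Section cap_mass_upper.
Context {R : realType} {d : nat}.
Hypothesis d2 : (2 <= d)%N.
Variables beta gamma : R.
Hypothesis hbeta : - d%:R < beta.
Hypothesis hgamma : -1 < gamma.
Implicit Types (xi eta : d.-tuple R) (t s r : R).

Let p : R := @radial_exponent R d beta.
Let p1 : -1 < p. Proof. by rewrite /p /radial_exponent ltrBrDr addNr -ltrBlDr sub0r. Qed.
Let d0 : (0 < d)%N. Proof. exact: ltnW. Qed.

Definition cap_bound t r : R :=
  r ^+ d * (t + r ^+ 2) `^ (beta + d%:R / 2) * (1 - t + r ^+ 2) `^ (gamma + 1 / 2).

(** Separates the measure of the spherical slice, (r / sqrt T)^(d-1), from the radial integral, by p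
    + 1/2 = (beta + d/2) + (d-1)/2. *)
Lemma cap_boundE t r : 0 <= t <= 1 -> 0 < r ->
  cap_bound t r = (r / Num.sqrt (t + r ^+ 2)) ^+ d.-1 *
    (r * (t + r ^+ 2) `^ (p + 2^-1) * (1 - t + r ^+ 2) `^ (gamma + 2^-1)).
Proof.
move=> /andP[t0 t1] r0; have r20 : 0 < r ^+ 2 by rewrite exprn_gt0.
have T0 : 0 < t + r ^+ 2 by lra.
rewrite /cap_bound div1r !mulrA; congr (_ * _).
have -> : p + 2^-1 = (beta + d%:R / 2) + 2^-1 * d.-1%:R.
  rewrite /p /radial_exponent; case: d d0 => // n _ /=.
  by rewrite -natr1; field.
rewrite [X in _ = _ * _ * X]powRD ?(gt_eqF T0) ?implybT// powRrM powR12_sqrt ?(ltW T0)//.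
rewrite powR_mulrn ?sqrtr_ge0// expr_div_n.
have -> : r ^+ d = r ^+ d.-1 * r by rewrite -exprSr prednK.
by field; rewrite expf_neq0// gt_eqF// sqrtr_gt0.
Qed.

Lemma cap_mass_le_near : exists2 C : R, 0 < C &
  forall (q : d.-tuple R * R) r, conic_surface q -> 0 < r <= 1 / 4 ->
  (weight_mass (jacobi_weight beta gamma) (cone_cap q r)
   <= (C * cap_bound q.2 r)%:E)%E.
Proof.
have [C0 C00 hC0] := @sphere_measure_cap_le R d d0.
have [C1 C10 hC1] :=
  integral_powR_near (@measurable_id _ _ _) (@lebesgue_preimage_id_le R) p1.
have [C2 C20 hC2] :=
  integral_powR_near (@measurable_onem_fun R) (@lebesgue_preimage_onem_le R) hgamma.
pose K1 := 16 `^ `|gamma| * (C0 * 4 ^+ d.-1).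
pose K2 := 16 `^ `|p| * (C0 * 4 ^+ d.-1).
have K10 : 0 < K1 by rewrite !mulr_gt0 ?powR_gt0 ?exprn_gt0.
have K20 : 0 < K2 by rewrite !mulr_gt0 ?powR_gt0 ?exprn_gt0.
pose L1 := K1 * C1 * 2 `^ `|gamma + 2^-1|.
pose L2 := K2 * C2 * 2 `^ `|p + 2^-1|.
have L10 : 0 < L1 by rewrite !mulr_gt0 ?powR_gt0.
have L20 : 0 < L2 by rewrite !mulr_gt0 ?powR_gt0.
exists (L1 + L2); first by rewrite addr_gt0.
move=> q r cq /andP[r0 r4]; have [xi xi1 qE] := conic_surface_polar d0 cq.
have t01 : 0 <= q.2 <= 1 by case: cq.
rewrite (surjective_pairing q) qE /=.
move: (q.2) t01 => t t01 {qE cq q}; have /andP[t0 t1] := t01.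
have r20 : 0 < r ^+ 2 by rewrite exprn_gt0.
have r2le : r ^+ 2 <= 1 / 16 by rewrite expr2; nra.
have T0 : 0 < t + r ^+ 2 by lra.
have V0 : 0 < 1 - t + r ^+ 2 by lra.
have T2 : t + r ^+ 2 <= 2 by lra.
have V2 : 1 - t + r ^+ 2 <= 2 by lra.
have T1 : 1 / 2 < t -> 1 <= 2 * (t + r ^+ 2) by lra.
have V1 : t <= 1 / 2 -> 1 <= 2 * (1 - t + r ^+ 2) by lra.
have t10 : 0 <= 1 - t by lra.
have r01 : 0 < r <= 1 by rewrite r0/=; lra.
set rho := r / Num.sqrt (t + r ^+ 2).
have rho0 : 0 < rho by rewrite divr_gt0// sqrtr_gt0.
have D0 : 0 <= rho ^+ d.-1 by rewrite exprn_ge0// ltW.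
pose J := [set s : R | 0 <= s <= 1 /\ (`|Num.sqrt s - Num.sqrt t| <= r /\
  `|Num.sqrt (1 - s) - Num.sqrt (1 - t)| <= r)].
have slice_le s : 0 <= s <= 1 ->
  (\int[@sphere_measure R d]_(eta in sphere_slice (cone_cap (tscale t xi, t) r) s)
     (@radial_density R d beta gamma s)%:E
   <= (@radial_density R d beta gamma s * (C0 * 4 ^+ d.-1 * rho ^+ d.-1))%:E)%E.
  move=> s01; have /andP[s0 _] := s01.
  apply: (slice_integral_le _ _ s0 (measurable_spherical_cap _ _)
    (cap_slice_sub t01 xi1 r01 s01)).
  rewrite -mulrA -exprMn; apply: hC0 => //.
  by rewrite mulr_gt0.
have slice_ge0 s : 0 <= s ->
  (0 <= \int[@sphere_measure R d]_(eta in sphere_slice (cone_cap (tscale t xi, t) r) s)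
     (@radial_density R d beta gamma s)%:E)%E.
  by move=> s0; apply: integral_ge0 => eta _; rewrite lee_fin radial_density_ge0.
have slice0 s : 0 <= s <= 1 -> ~ J s ->
  (\int[@sphere_measure R d]_(eta in sphere_slice (cone_cap (tscale t xi, t) r) s)
     (@radial_density R d beta gamma s)%:E = 0)%E.
  move=> s01 nJ; rewrite (cap_slice_empty t01 xi1 r01 s01) ?integral_set0//.
  by move=> h; apply: nJ.
have bE := cap_boundE t01 r0.
rewrite weight_mass_jacobiE.
have [t12|t12] := leP t (1 / 2).
  apply: (@le_trans _ _ (K1 * rho ^+ d.-1 * (C1 * (r * (t + r ^+ 2) `^ (p + 2^-1))))%:E); last first.
    rewrite lee_fin bE.
    have h1 : 1 <= 2 `^ `|gamma + 2^-1| * (1 - t + r ^+ 2) `^ (gamma + 2^-1).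
      by apply: powR_ge_unit (V1 t12) V2; rewrite ler1n.
    have -> : K1 * rho ^+ d.-1 * (C1 * (r * (t + r ^+ 2) `^ (p + 2^-1))) =
      K1 * C1 * (rho ^+ d.-1 * (r * (t + r ^+ 2) `^ (p + 2^-1))) by rewrite mulrACA.
    rewrite [rho ^+ _ * (_ * _ * _)]mulrA.
    by apply: ler_mul_absorb => //; rewrite ?mulr_ge0 ?powR_ge0// ltW.
  have M0 : 0 <= K1 * rho ^+ d.-1 by rewrite mulr_ge0// ltW.
  apply: le_trans (hC1 t r _ t0 r0 M0).
  apply: ge0_le_integral_dom => s /=; rewrite ?in_itv/=.
  - by move=> /andP[s0 _]; exact: slice_ge0.
  - by move=> [s0 _]; rewrite lee_fin mulr_ge0 ?powR_ge0.
  - move=> s01 [_ hs]; apply: le_trans (slice_le s s01) _; rewrite lee_fin.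
    have /andP[s0 s1] := s01.
    have hs1 := level_away_from_one (introT andP (conj t0 t12)) s0 r4 hs.
    have hg : (1 - s) `^ gamma <= 16 `^ `|gamma|.
      by apply: powR_le_unit; rewrite ?ler1n ?gerBl.
    apply: (@le_trans _ _ (s `^ p * 16 `^ `|gamma| * (C0 * 4 ^+ d.-1 * rho ^+ d.-1))).
      apply: ler_wpM2r; first by rewrite !mulr_ge0// ?exprn_ge0// ltW.
      apply: le_trans (radial_density_le d2 _ _ s0) _.
      by apply: ler_wpM2l; rewrite ?powR_ge0.
    by rewrite /K1 le_eqVlt; apply/orP; left; apply/eqP; ring.
  - move=> s01 nJ; apply: slice0 => // -[_ [hs _]]; apply: nJ; split => //.
    by case/andP: s01.
have t02 : 0 <= 1 - t <= 1 / 2 by rewrite t10/=; lra.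
apply: (@le_trans _ _ (K2 * rho ^+ d.-1 * (C2 * (r * (1 - t + r ^+ 2) `^ (gamma + 2^-1))))%:E); last first.
  rewrite lee_fin bE.
  have h1 : 1 <= 2 `^ `|p + 2^-1| * (t + r ^+ 2) `^ (p + 2^-1).
    by apply: powR_ge_unit (T1 t12) T2; rewrite ler1n.
  have -> : K2 * rho ^+ d.-1 * (C2 * (r * (1 - t + r ^+ 2) `^ (gamma + 2^-1))) =
    K2 * C2 * (rho ^+ d.-1 * (r * (1 - t + r ^+ 2) `^ (gamma + 2^-1))) by rewrite mulrACA.
  rewrite (addrC L1) (mulrAC r) [rho ^+ _ * (_ * _ * _)]mulrA.
  by apply: ler_mul_absorb => //; rewrite ?mulr_ge0 ?powR_ge0// ltW.
have M0 : 0 <= K2 * rho ^+ d.-1 by rewrite mulr_ge0// ltW.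
apply: le_trans (hC2 (1 - t) r _ t10 r0 M0).
apply: ge0_le_integral_dom => s /=; rewrite ?in_itv/=.
- by move=> /andP[s0 _]; exact: slice_ge0.
- by move=> [s0 _]; rewrite lee_fin mulr_ge0 ?powR_ge0.
- move=> s01 [_ hs]; apply: le_trans (slice_le s s01) _; rewrite lee_fin.
  have /andP[s0 s1] := s01.
  have s10 : 0 <= 1 - s by rewrite subr_ge0.
  have := level_away_from_one t02 s10 r4 hs; rewrite subKr => hs1.
  have hg : s `^ p <= 16 `^ `|p| by apply: powR_le_unit; rewrite ?ler1n.
  apply: (@le_trans _ _ (16 `^ `|p| * (1 - s) `^ gamma * (C0 * 4 ^+ d.-1 * rho ^+ d.-1))).
    apply: ler_wpM2r; first by rewrite !mulr_ge0// ?exprn_ge0// ltW.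
    apply: le_trans (radial_density_le d2 _ _ s0) _.
    by apply: ler_wpM2r; rewrite ?powR_ge0.
  by rewrite /K2 le_eqVlt; apply/orP; left; apply/eqP; ring.
- move=> s01 nJ; apply: slice0 => // -[_ [_ hs]]; apply: nJ; split => //.
  by rewrite subr_ge0; case/andP: s01.
Qed.

End cap_mass_upper.

(** * Finite total mass, and the lower bound for the mass of a cap *)

Section cap_mass_lower.
Context {R : realType} {d : nat}.
Hypothesis d2 : (2 <= d)%N.
Variables beta gamma : R.
Hypothesis hbeta : - d%:R < beta.
Hypothesis hgamma : -1 < gamma.
Implicit Types (xi eta : d.-tuple R) (t s r : R).

Let p : R := @radial_exponent R d beta.
Let p1 : -1 < p.
Proof. by rewrite /p /radial_exponent ltrBrDr addNr -ltrBlDr sub0r. Qed.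
Let d0 : (0 < d)%N. Proof. exact: ltnW. Qed.

(** One of s and 1 - s is at least 1/2, so the product of the two powers is dominated by the sum of
    the single powers with constant weights, each integrable on [0,1]. *)
Lemma surface_mass_finite : exists2 C : R, 0 < C &
  (weight_mass (@jacobi_weight R d beta gamma) conic_surface <= C%:E)%E.
Proof.
have [C0 C00 hC0] := @sphere_measure_cap_le R d d0.
have [C1 C10 hC1] :=
  integral_powR_le (@measurable_id _ _ _) (@lebesgue_preimage_id_le R) p1.
have [C2 C20 hC2] :=
  integral_powR_le (@measurable_onem_fun R) (@lebesgue_preimage_onem_le R) hgamma.
pose K1 := 2 `^ `|gamma| * (C0 * 2 ^+ d.-1).
pose K2 := 2 `^ `|p| * (C0 * 2 ^+ d.-1).
have K10 : 0 < K1 by rewrite !mulr_gt0 ?powR_gt0 ?exprn_gt0.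
have K20 : 0 < K2 by rewrite !mulr_gt0 ?powR_gt0 ?exprn_gt0.
exists (K1 * C1 + K2 * C2); first by rewrite addr_gt0// mulr_gt0.
have [xi xi1] := @exists_unit R d d0.
have m1 : measurable_fun setT (fun s : R => (s `^ p)%:E).
  by apply/measurable_EFinP; exact: measurable_powR.
have m2 : measurable_fun setT (fun s : R => ((1 - s) `^ gamma)%:E).
  apply/measurable_EFinP.
  exact: (measurableT_comp (measurable_powR gamma) (@measurable_onem_fun R)).
rewrite weight_mass_jacobiE.
apply: (@le_trans _ _ (\int[lebesgue_measure]_(s in `[0%R, 1%R])
    (K1%:E * (s `^ p)%:E + K2%:E * ((1 - s) `^ gamma)%:E))%E).
  apply: ge0_le_integral_dom => s /=; rewrite ?in_itv/=.
  - move=> /andP[s0 _]; apply: integral_ge0 => eta _.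
    by rewrite lee_fin radial_density_ge0.
  - by move=> _; rewrite adde_ge0// lee_fin mulr_ge0 ?powR_ge0// ltW.
  - move=> /andP[s0 s1] _.
    apply: (@le_trans _ _ (@radial_density R d beta gamma s * (C0 * 2 ^+ d.-1))%:E).
      apply: (slice_integral_le _ _ s0 (measurable_spherical_cap xi (2 ^+ 2))); last exact: hC0.
      move=> eta [/= eta1 _]; split => //.
      by have /andP[] := dotp_unit_bounds xi1 eta1; lra.
    rewrite -!EFinM -EFinD lee_fin /K1 /K2.
    have X0 : 0 < C0 * 2 ^+ d.-1 by rewrite mulr_gt0// exprn_gt0.
    move: (C0 * 2 ^+ d.-1) X0 => X X0.
    have -> : 2 `^ `|gamma| * X * s `^ p + 2 `^ `|p| * X * (1 - s) `^ gamma =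
      X * (2 `^ `|gamma| * s `^ p + 2 `^ `|p| * (1 - s) `^ gamma) by ring.
    rewrite mulrC ler_pM2l//.
    apply: le_trans (radial_density_le d2 _ _ s0) _.
    have a0 : 0 <= s `^ p by exact: powR_ge0.
    have b0 : 0 <= (1 - s) `^ gamma by exact: powR_ge0.
    have [s12|s12] := leP s (1 / 2).
      have hg : (1 - s) `^ gamma <= 2 `^ `|gamma|.
        by apply: powR_le_unit => //; lra.
      have h2 : 0 <= 2 `^ `|p| * (1 - s) `^ gamma by rewrite mulr_ge0 ?powR_ge0.
      by have := ler_wpM2l a0 hg; rewrite -/p; lra.
    have hg : s `^ p <= 2 `^ `|p| by apply: powR_le_unit => //; lra.
    have h2 : 0 <= 2 `^ `|gamma| * s `^ p by rewrite mulr_ge0 ?powR_ge0.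
    by have := ler_wpM2r b0 hg; rewrite -/p; lra.
  - by [].
have mI : measurable (`[0%R, 1%R]%classic : set (measurableTypeR R)) by exact: measurable_itv.
rewrite ge0_integralD//; last 4 first.
- by move=> s _; rewrite lee_fin mulr_ge0 ?powR_ge0// ltW.
- by apply: measurable_funTS; apply: emeasurable_funM => //; exact: measurable_cst.
- by move=> s _; rewrite lee_fin mulr_ge0 ?powR_ge0// ltW.
- by apply: measurable_funTS; apply: emeasurable_funM => //; exact: measurable_cst.
rewrite EFinD; apply: leeD.
  rewrite ge0_integralZl_EFin ?(ltW K10)//; last 2 first.
  - by move=> s _; rewrite lee_fin powR_ge0.
  - exact: measurable_funTS.
  rewrite (EFinM K1); apply: lee_wpmul2l; first by rewrite lee_fin ltW.
  by have := hC1 1 ltr01; rewrite powR1 mulr1 preimage_id.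
rewrite ge0_integralZl_EFin ?(ltW K20)//; last 2 first.
- by move=> s _; rewrite lee_fin powR_ge0.
- exact: measurable_funTS.
rewrite (EFinM K2); apply: lee_wpmul2l; first by rewrite lee_fin ltW.
have := hC2 1 ltr01; rewrite powR1 mulr1; apply: le_trans.
apply: ge0_le_integral_dom => s /=; rewrite ?in_itv/=.
- by move=> _; rewrite lee_fin powR_ge0.
- by move=> _; rewrite lee_fin powR_ge0.
- by [].
- by move=> /andP[s0 s1] []; apply/andP; split; lra.
Qed.

(** The hypotheses on [[a, b]] say that the density is comparable to T^p V^gamma there and that a
    full spherical cap over each level lies in the conic cap. Leaving the interval abstract covers
    both halves of the surface. *)
Lemma cap_mass_ge_interval t xi r a b (c0 : R) : 0 <= t <= 1 -> enorm xi = 1 ->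
  0 < r <= 1 -> a <= b -> 0 <= c0 ->
  (forall eta (rho : R), enorm eta = 1 -> 0 < rho <= 1 ->
    ((c0 * rho ^+ d.-1)%:E <= sphere_measure (spherical_cap eta (rho ^+ 2)))%E) ->
  (forall s, a <= s <= b ->
    [/\ 0 < s < 1, s <= 64 * (t + r ^+ 2) /\ t + r ^+ 2 <= 64 * s,
        1 - s <= 64 * (1 - t + r ^+ 2) /\ 1 - t + r ^+ 2 <= 64 * (1 - s),
        (Num.sqrt t - Num.sqrt s) ^+ 2
          + (Num.sqrt (1 - t) - Num.sqrt (1 - s)) ^+ 2 <= r ^+ 2 / 4 &
        Num.sqrt t * Num.sqrt s <= 2 * (t + r ^+ 2)]) ->
  (((64 `^ `|p|)^-1 * (64 `^ `|gamma|)^-1 * c0 * 4^-1 ^+ d.-1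
     * ((r / Num.sqrt (t + r ^+ 2)) ^+ d.-1
        * (t + r ^+ 2) `^ p * (1 - t + r ^+ 2) `^ gamma * (b - a)))%:E
   <= weight_mass (jacobi_weight beta gamma) (cone_cap (tscale t xi, t) r))%E.
Proof.
move=> t01 xi1 /andP[r0 r1] ab c00 hc0 hI; have /andP[t0 t1] := t01.
have r20 : 0 < r ^+ 2 by rewrite exprn_gt0.
set T := t + r ^+ 2 in hI *; set V := 1 - t + r ^+ 2 in hI *.
have T0 : 0 < T by rewrite /T; lra.
have V0 : 0 < V by rewrite /V; lra.
(* With sqrt(ts) <= 2T the angular term is at most 2 T rho^2 = r^2/8, within the r^2/4 granted by
   [le_cone_dist]. *)
pose rho := 4^-1 * (r / Num.sqrt T).
have sT0 : 0 < Num.sqrt T by rewrite sqrtr_gt0.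
have rho0 : 0 < rho by rewrite mulr_gt0// divr_gt0.
have rT : r / Num.sqrt T <= 1.
  rewrite ler_pdivrMr// mul1r -(@ler_pXn2r _ 2)// ?nnegrE ?(ltW r0) ?(ltW sT0)//.
  by rewrite sqr_sqrtr ?(ltW T0)// /T lerDr.
have rho1 : rho <= 1 by rewrite /rho; lra.
have rho2 : 2 * (T * rho ^+ 2) <= r ^+ 2 / 4.
  rewrite /rho exprMn expr_div_n sqr_sqrtr ?(ltW T0)//.
  rewrite [X in 2 * X](_ : _ = r ^+ 2 / 16); last by field; rewrite gt_eqF.
  by lra.
set m := (64 `^ `|p|)^-1 * (64 `^ `|gamma|)^-1 * (T `^ p * V `^ gamma) * (c0 * rho ^+ d.-1).
rewrite [X in (X%:E <= _)%E](_ : _ = m * (b - a)); last first.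
  rewrite /m /rho (exprMn _ 4^-1); move: (4^-1 ^+ _) ((r / _) ^+ _) => u v.
  by ring.
have A0 : 0 < 64 `^ `|p| by rewrite powR_gt0.
have G0 : 0 < 64 `^ `|gamma| by rewrite powR_gt0.
have m0 : 0 <= m.
  by rewrite /m !mulr_ge0 ?invr_ge0 ?powR_ge0// exprn_ge0// ltW.
rewrite weight_mass_jacobiE.
have mI : measurable (`[a, b]%classic : set (measurableTypeR R)) by exact: measurable_itv.
apply: (@le_trans _ _ (\int[lebesgue_measure]_(s in `[a, b]) (cst m%:E s))%E).
  rewrite integral_cst// -[X in (_ <= _ * X)%E]/(lebesgue_measure _).
  rewrite lebesgue_measure_itv/= lte_fin.
  case: ifPn => [_|]; first by rewrite -EFinB.
  by rewrite -leNgt => ba; rewrite (@le_anti _ _ a b) ?ab// subrr mulr0 mule0.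
apply: ge0_le_integral_dom => s /=; rewrite ?in_itv/=.
- by move=> _; rewrite lee_fin.
- move=> /andP[s0 _]; apply: integral_ge0 => eta _.
  by rewrite lee_fin radial_density_ge0.
- move=> sI /andP[s0 s1].
  have [/andP[sp s1'] [sT Ts] [sV Vs] hs hts] := hI s sI.
  apply: (@le_trans _ _ (@radial_density R d beta gamma s * (c0 * rho ^+ d.-1))%:E).
    rewrite lee_fin /m; apply: ler_wpM2r; first by rewrite mulr_ge0// exprn_ge0// ltW.
    rewrite radial_densityE// mulrACA; apply: ler_pM;
      rewrite ?mulr_ge0 ?invr_ge0 ?powR_ge0//.
      by rewrite ler_pdivrMl//; apply: powR_le_comparable; rewrite ?ler1n.
    by rewrite ler_pdivrMl//; apply: powR_le_comparable; rewrite ?ler1n ?subr_gt0.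
  apply: (slice_integral_ge _ _ s0 (measurable_spherical_cap xi (rho ^+ 2))).
    move=> eta [eta1 hu]; split => //=.
    have s01 : 0 <= s <= 1 by rewrite s0 s1.
    apply/(cone_capE r t01 s01 xi1 eta1).
    have u1 := dotp_unit_bounds xi1 eta1.
    apply: le_cone_dist => //; first by rewrite r1 ltW.
    have {}u1 : 0 <= 1 - dotp xi eta by rewrite subr_ge0; case/andP: u1.
    apply: (@le_trans _ _ (2 * T * rho ^+ 2)); last by rewrite -mulrA.
    by apply: ler_pM => //; rewrite mulr_ge0 ?sqrtr_ge0.
  by apply: hc0; rewrite // rho0.
- move=> sI; have [/andP[s0 s1] _ _ _ _] := hI s sI.
  by move=> []; rewrite !ltW.
Qed.

Lemma cap_mass_ge : exists2 c : R, 0 < c &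
  forall (q : d.-tuple R * R) r, conic_surface q -> 0 < r <= 1 ->
  ((c * @cap_bound R d beta gamma q.2 r)%:E
   <= weight_mass (jacobi_weight beta gamma) (cone_cap q r))%E.
Proof.
have [c0 c00 hc0] := @sphere_measure_cap_ge R d d0.
pose K := (64 `^ `|p|)^-1 * (64 `^ `|gamma|)^-1 * c0 * 4^-1 ^+ d.-1.
have K0 : 0 < K by rewrite !mulr_gt0 ?invr_gt0 ?powR_gt0// exprn_gt0// invr_gt0.
exists (K * 128^-1); first by rewrite mulr_gt0.
move=> q r cq r01; have [xi xi1 qE] := conic_surface_polar d0 cq.
have t01 : 0 <= q.2 <= 1 by case: cq.
rewrite (surjective_pairing q) qE /=.
move: (q.2) t01 => t t01 {qE cq q}; have /andP[t0 t1] := t01.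
have /andP[r0 r1] := r01.
have r20 : 0 < r ^+ 2 by rewrite exprn_gt0.
have r21 : r ^+ 2 <= 1 by rewrite expr2; nra.
have T0 : 0 < t + r ^+ 2 by lra.
have V0 : 0 < 1 - t + r ^+ 2 by lra.
have sqrt_le2 (x : R) : x <= 2 -> Num.sqrt x <= 2.
  move=> x2; have [x0|x0] := leP x 0; first by rewrite ler0_sqrtr.
  rewrite -(@ler_pXn2r _ 2)// ?nnegrE ?sqrtr_ge0//.
  by rewrite sqr_sqrtr ?(ltW x0)// expr2; lra.
have sT2 : Num.sqrt (t + r ^+ 2) <= 2 by apply: sqrt_le2; lra.
have sV2 : Num.sqrt (1 - t + r ^+ 2) <= 2 by apply: sqrt_le2; lra.
(* The bound contains r sqrt T sqrt V, while [L] is r/64 times only one of the roots. The other is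
   at most 2, hence 128. *)
have key (K' L a b : R) : 0 < K' -> a + L = b ->
    128^-1 * (r * Num.sqrt (t + r ^+ 2) * Num.sqrt (1 - t + r ^+ 2)) <= L ->
    K' * 128^-1 * @cap_bound R d beta gamma t r <=
    K' * ((r / Num.sqrt (t + r ^+ 2)) ^+ d.-1
        * (t + r ^+ 2) `^ p * (1 - t + r ^+ 2) `^ gamma * (b - a)).
  move=> K'0 <- hL; rewrite (cap_boundE d2)// -/p -[leLHS]mulrA ler_pM2l//.
  rewrite (@powRD _ _ p) ?(gt_eqF T0) ?implybT//.
  rewrite (@powRD _ _ gamma) ?(gt_eqF V0) ?implybT//.
  rewrite !powR12_sqrt ?(ltW T0) ?(ltW V0)// (addrC a) addrK.
  set D := (_ / _) ^+ _.
  have D0 : 0 <= D by rewrite exprn_ge0// divr_ge0 ?sqrtr_ge0// ltW.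
  have X0 : 0 <= D * ((t + r ^+ 2) `^ p * (1 - t + r ^+ 2) `^ gamma).
    by rewrite !mulr_ge0 ?powR_ge0.
  have := ler_wpM2l X0 hL.
  move: ((t + r ^+ 2) `^ p) ((1 - t + r ^+ 2) `^ gamma) D {D0 X0} => x y D.
  by lra.
have sTg := sqrtr_ge0 (t + r ^+ 2); have sVg := sqrtr_ge0 (1 - t + r ^+ 2).
have [t12|t12] := leP t (1 / 2).
  pose L := 64^-1 * (r * Num.sqrt (t + r ^+ 2)).
  have L0 : 0 <= L by rewrite !mulr_ge0// ltW.
  have t02 : 0 <= t <= 1 / 2 by rewrite t0.
  apply: le_trans (cap_mass_ge_interval (a := t + L) (b := t + 2 * L)
    t01 xi1 r01 _ (ltW c00) hc0 _).
  - rewrite lee_fin; apply: (key _ L) => //; first by lra.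
    rewrite /L.
    have := ler_wpM2l (mulr_ge0 (ltW r0) sTg) sV2; lra.
  - by lra.
  - by move=> s; exact: shifted_level_bounds t02 r01 erefl.
pose L := 64^-1 * (r * Num.sqrt (1 - t + r ^+ 2)).
have L0 : 0 <= L by rewrite !mulr_ge0// ltW.
have t02 : 0 <= 1 - t <= 1 / 2 by lra.
apply: le_trans (cap_mass_ge_interval (a := t - 2 * L) (b := t - L)
    t01 xi1 r01 _ (ltW c00) hc0 _).
- rewrite lee_fin; apply: (key _ L) => //; first by lra.
  rewrite /L.
  have := ler_wpM2l (mulr_ge0 (ltW r0) sVg) sT2; lra.
- by lra.
- move=> s /andP[s1 s2]; have sI : 1 - t + L <= 1 - s <= 1 - t + 2 * L.
    by apply/andP; split; lra.
  have [/andP[s1' s0'] sV sT hs _] := shifted_level_bounds t02 r01 erefl sI.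
  have e1 : 1 - (1 - t) = t by ring.
  have e2 : 1 - (1 - s) = s by ring.
  rewrite e1 e2 in sT hs.
  have s0 : 0 < s by move: s0'; rewrite gtrBl.
  have s01 : 0 < s < 1 by rewrite s0 -subr_gt0.
  split=> //; first by rewrite addrC.
  (* Reflection bounds sqrt((1-t)(1-s)) rather than sqrt(ts). The latter is at most 1 here, and 2 T
     >= 1 since t > 1/2. *)
  have /andP[_ s1''] := s01.
  by have := sqrtM_le_mean t0 (ltW s0); lra.
Qed.

End cap_mass_lower.

(** * Two-sided bounds for all bounded radii, and doubling *)

Section cap_mass_two_sided.
Context {R : realType} {d : nat}.
Hypothesis d2 : (2 <= d)%N.
Variables beta gamma : R.
Hypothesis hbeta : - d%:R < beta.
Hypothesis hgamma : -1 < gamma.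
Implicit Types (t r l : R) (q : d.-tuple R * R).

Let d0 : (0 < d)%N. Proof. exact: ltnW. Qed.
Let B := @cap_bound R d beta gamma.
Let W := weight_mass (@jacobi_weight R d beta gamma).

Definition cap_index : R :=
  d%:R + 2 * Num.max 0 (beta + d%:R / 2) + 2 * Num.max 0 (gamma + 1 / 2).

Lemma cap_index_gt0 : 0 < cap_index.
Proof. by rewrite /cap_index !ltr_wpDr ?mulr_ge0 ?le_max ?lexx// ltr0n. Qed.

Lemma cap_bound_gt0 t r : 0 <= t <= 1 -> 0 < r -> 0 < B t r.
Proof.
move=> /andP[t0 t1] r0; have r20 : 0 < r ^+ 2 by rewrite exprn_gt0.
rewrite /B /cap_bound mulr_gt0//; last by rewrite powR_gt0//; lra.
by rewrite mulr_gt0 ?exprn_gt0// powR_gt0//; lra.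
Qed.

(** Enlarging the radius by a factor at most l enlarges T and V by at most l^2. A positive exponent
    a thus costs l^(2a), and a negative one costs nothing because its power decreases; this is the
    origin of the maxima in [cap_index]. *)
Lemma cap_bound_growth l t r r' : 0 <= t <= 1 -> 1 <= l -> 0 < r -> r <= r' ->
  r' <= l * r -> B t r' <= l `^ cap_index * B t r.
Proof.
move=> /andP[t0 t1] l1 r0 rr' r'l; have l0 : 0 < l by exact: lt_le_trans l1.
have r20 : 0 < r ^+ 2 by rewrite exprn_gt0.
have r'0 : 0 < r' by exact: lt_le_trans rr'.
have l21 : 1 <= l ^+ 2 by rewrite exprn_ege1.
have rr2 : r ^+ 2 <= r' ^+ 2 by apply: lerXn2r; rewrite ?nnegrE ?(ltW r0) ?(ltW r'0).
have rl2 : r' ^+ 2 <= l ^+ 2 * r ^+ 2.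
  by rewrite -exprMn; apply: lerXn2r; rewrite ?nnegrE ?mulr_ge0 ?(ltW l0) ?(ltW r0) ?(ltW r'0).
have growth (x a : R) : 0 <= x ->
    (x + r' ^+ 2) `^ a <= l `^ (2 * Num.max 0 a) * (x + r ^+ 2) `^ a.
  move=> x0; rewrite powRrM (powR_mulrn 2) ?(ltW l0)//.
  apply: powR_le_growth => //; [by lra|by lra|].
  have : x <= l ^+ 2 * x by rewrite ler_peMl.
  by lra.
have -> : l `^ cap_index = l ^+ d * l `^ (2 * Num.max 0 (beta + d%:R / 2))
    * l `^ (2 * Num.max 0 (gamma + 1 / 2)).
  by rewrite /cap_index !powRD ?(gt_eqF l0) ?implybT// powR_mulrn// ltW.
rewrite /B /cap_bound mulrACA; apply: ler_pM; rewrite ?powR_ge0//.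
- by rewrite mulr_ge0 ?powR_ge0// exprn_ge0// ltW.
- rewrite mulrACA; apply: ler_pM; rewrite ?powR_ge0// ?exprn_ge0 ?(ltW r'0)//.
    rewrite -exprMn; apply: lerXn2r r'l; rewrite ?nnegrE ?mulr_ge0 ?(ltW l0) ?(ltW r0)//.
    exact: ltW.
  exact: growth.
- by apply: growth; rewrite subr_ge0.
Qed.

(** Radii above 1 use the cap of radius 1 for the lower bound and [cap_bound_growth] to compare the
    bounds. Radii above 1/4 use the total mass for the upper bound, as the claimed bound is then
    bounded away from 0. *)
Lemma cap_mass_two_sided (r0 : R) : 0 < r0 -> exists c C : R, [/\ 0 < c, 0 < C &
  forall q r, conic_surface q -> 0 < r <= r0 ->
    ((c * B q.2 r)%:E <= W (cone_cap q r))%E /\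
    (W (cone_cap q r) <= (C * B q.2 r)%:E)%E].
Proof.
move=> r00; have [C1 C10 hC1] := cap_mass_le_near d2 hbeta hgamma.
have [C2 C20 hC2] := surface_mass_finite d2 hbeta hgamma.
have [c c0 hc] := cap_mass_ge d2 beta gamma.
have [l l1 rl] : exists2 l : R, 1 <= l & r0 <= l by exists (1 + r0); lra.
have l0 : 0 < l by lra.
have li1 : 1 <= l `^ cap_index.
  by rewrite -(powRr0 l); apply: ler_powR => //; rewrite ltW// cap_index_gt0.
(* For r between 1/4 and r0, T and V lie in [1/16, 1 + r0^2], so [k] bounds them and their
   inverses. *)
pose k : R := 16 * (1 + r0 ^+ 2).
have r020 : 0 <= r0 ^+ 2 by exact: sqr_ge0.
have k1 : 1 <= k by rewrite /k; lra.
pose K := 4 ^+ d * k `^ `|beta + d%:R / 2| * k `^ `|gamma + 1 / 2|.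
have K0 : 0 < K by rewrite !mulr_gt0 ?exprn_gt0 ?powR_gt0//; lra.
exists (c / l `^ cap_index), (C1 + C2 * K); split.
- by rewrite divr_gt0//; lra.
- by rewrite addr_gt0// mulr_gt0.
move=> q r cq /andP[rp rr0]; have t01 : 0 <= q.2 <= 1 by case: cq.
have /andP[t0 t1] := t01; have Bp := cap_bound_gt0 t01 rp.
split.
  have [r1|r1] := leP r 1.
    apply: le_trans (hc q r cq _); last by rewrite rp.
    rewrite lee_fin; apply: ler_wpM2r; first exact: ltW.
    by rewrite ler_pdivrMr; [rewrite ler_peMr// ltW|lra].
  apply: (@le_trans _ _ (W (cone_cap q 1))); last first.
    by apply: weight_mass_mono; apply: cone_cap_mono; exact: ltW.
  apply: le_trans (hc q 1 cq _); last by rewrite ltr01 lexx.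
  rewrite lee_fin -mulrA ler_pM2l// ler_pdivrMl; last by lra.
  by apply: cap_bound_growth => //; lra.
have [r4|r4] := leP r (1 / 4).
  apply: le_trans (hC1 q r cq _) _; first by rewrite rp.
  rewrite lee_fin; apply: ler_wpM2r; first exact: ltW.
  by rewrite lerDl mulr_ge0// ltW.
apply: (@le_trans _ _ (W conic_surface)).
  by apply: weight_mass_mono; exact: cone_cap_sub_surface.
apply: le_trans hC2 _; rewrite lee_fin mulrDl.
suff h : 1 <= K * B q.2 r.
  have := ler_wpM2l (ltW C20) h; have := mulr_gt0 C10 Bp; lra.
have r2 : 1 / 16 <= r ^+ 2 by rewrite expr2; nra.
have r2' : r ^+ 2 <= r0 ^+ 2.
  by apply: lerXn2r; rewrite ?nnegrE ?(ltW rp) ?(ltW r00).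
have unit (x a : R) : 0 <= x <= 1 -> 1 <= k `^ `|a| * (x + r ^+ 2) `^ a.
  by move=> x01; apply: powR_ge_unit; rewrite /k in k1 *; [lra|nra|lra].
have h1 := unit _ (beta + d%:R / 2) t01.
have t01' : 0 <= 1 - q.2 <= 1 by lra.
have h2 := unit _ (gamma + 1 / 2) t01'.
have h3 : 1 <= 4 ^+ d * r ^+ d by rewrite -exprMn exprn_ege1//; lra.
have -> : K * B q.2 r = (4 ^+ d * r ^+ d) *
   (k `^ `|beta + d%:R / 2| * (q.2 + r ^+ 2) `^ (beta + d%:R / 2)) *
   (k `^ `|gamma + 1 / 2| * (1 - q.2 + r ^+ 2) `^ (gamma + 1 / 2)).
  rewrite /K /B /cap_bound.
  by rewrite (mulrACA (4 ^+ d * _)) (mulrACA (4 ^+ d)).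
have ge1M (x y : R) : 1 <= x -> 1 <= y -> 1 <= x * y by move=> ? ?; nra.
exact: ge1M (ge1M _ _ h3 h1) h2.
Qed.

(** Caps of radius at least 2 are the whole surface. If r >= 2 both caps agree, which the summand 1
    of the constant covers; otherwise the enlarged radius may be cut off at 2, and the two-sided
    bounds with r0 = 2 combine with the growth of [cap_bound]. *)
Lemma doubling_index_jacobi :
  doubling_index (@jacobi_weight R d beta gamma) cap_index.
Proof.
split; first exact: cap_index_gt0.
have [c [C [c0 C0 h]]] := cap_mass_two_sided (ltr0n R 2).
exists (1 + C / c); first by rewrite addr_gt0// divr_gt0.
move=> q r m cq r0 m0.
have t01 : 0 <= q.2 <= 1 by case: cq.
have l1 : 1 <= 2 ^+ m :> R by rewrite exprn_ege1// ler1n.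
have lE : 2 `^ (cap_index * m%:R) = (2 ^+ m) `^ cap_index :> R.
  by rewrite mulrC powRrM powR_mulrn.
rewrite lE; have l2 : 1 <= (2 ^+ m) `^ cap_index :> R.
  by rewrite -[leLHS](powRr0 (2 ^+ m)); apply: ler_powR => //; rewrite ltW// cap_index_gt0.
have Cc0 : 0 < C / c by rewrite divr_gt0.
have [r2|r2] := leP 2 r.
  apply: (@le_trans _ _ (W (cone_cap q r))).
    apply: weight_mass_mono => x /cone_cap_sub_surface.
    exact: conic_surface_sub_cap.
  rewrite -[leLHS]mul1e; apply: lee_wpmul2r; first exact: weight_mass_ge0.
  by rewrite lee_fin; nra.
have [r' [rr' r'l r'2 sub]] : exists r', [/\ r <= r', r' <= 2 ^+ m * r, r' <= 2 &
    @cone_cap R d q (2 ^+ m * r) `<=` cone_cap q r'].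
  have [h2|h2] := leP (2 ^+ m * r) 2.
    by exists (2 ^+ m * r); split => //; rewrite ler_peMl// ltW.
  exists 2; split=> //; [exact: ltW|exact: ltW|].
  by move=> x /cone_cap_sub_surface; exact: conic_surface_sub_cap.
have [_ hu] := h q r' cq (introT andP (conj (lt_le_trans r0 rr') r'2)).
have [hl _] := h q r cq (introT andP (conj r0 (ltW r2))).
apply: (@le_trans _ _ (W (cone_cap q r'))); first exact: weight_mass_mono.
apply: le_trans hu _.
apply: (@le_trans _ _ ((C / c * (2 ^+ m) `^ cap_index)%:E * (c * B q.2 r)%:E)%E).
  rewrite -EFinM lee_fin.
  have -> : C / c * (2 ^+ m) `^ cap_index * (c * B q.2 r) =
    C * ((2 ^+ m) `^ cap_index * B q.2 r) by field; rewrite gt_eqF.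
  by rewrite ler_pM2l//; exact: cap_bound_growth.
apply: (@le_trans _ _ ((C / c * (2 ^+ m) `^ cap_index)%:E * W (cone_cap q r))%E).
  by apply: lee_wpmul2l => //; rewrite lee_fin mulr_ge0 ?powR_ge0// ltW.
apply: lee_wpmul2r; first exact: weight_mass_ge0.
by rewrite lee_fin ler_wpM2r ?powR_ge0// lerDr.
Qed.

Lemma doubling_weight_jacobi : doubling_weight (@jacobi_weight R d beta gamma).
Proof.
have [_ [c c0 h]] := doubling_index_jacobi.
by exists (c * 2 `^ (cap_index * 1)) => q r cq r0; have := h q r 1%N cq r0 isT.
Qed.

(** As [fine] sends infinity to 0, the total mass must be shown finite as well as positive;
    positivity comes from the cap of radius 1 at the apex. *)
Lemma jacobi_const_gt0 : 0 < @jacobi_const R d beta gamma.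
Proof.
rewrite invr_gt0 fine_gt0//; apply/andP; split.
  have [c c0 hc] := cap_mass_ge d2 beta gamma.
  have cq : conic_surface ([tuple 0 | i < d] : d.-tuple R, 0 : R).
    split; last by rewrite /= lexx ler01.
    rewrite /= /enorm /dotp big1 ?sqrtr0// => i _.
    by rewrite !tnth_mktuple mulr0.
  have r1 : 0 < (1 : R) <= 1 by rewrite ltr01 lexx.
  have := weight_mass_mono beta gamma (@cone_cap_sub_surface R d ([tuple 0 | i < d], 0) 1).
  apply: lt_le_trans; apply: lt_le_trans (hc _ 1 cq r1).
  by rewrite lte_fin mulr_gt0// cap_bound_gt0//= lexx ler01.
have [C C0 hC] := surface_mass_finite d2 hbeta hgamma.
exact: le_lt_trans hC (ltry _).
Qed.

End cap_mass_two_sided.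

Theorem proposition4p6 (R : realType) (d : nat) (beta gamma : R)
    (hd : (2 <= d)%N) (hbeta : - d%:R < beta) (hgamma : -1 < gamma) :
  (forall r0 : R, 0 < r0 ->
     exists c' c : R, [/\ 0 < c', 0 < c &
       forall (p : d.-tuple R * R) (r : R),
         conic_surface p -> 0 < r <= r0 ->
         let t := p.2 in
         let B := r ^+ d * (t + r ^+ 2) `^ (beta + d%:R / 2)
                  * (1 - t + r ^+ 2) `^ (gamma + 1 / 2) in
         (c'%:E * jacobi_mass beta gamma (cone_cap p r) <= B%:E
          <= c%:E * jacobi_mass beta gamma (cone_cap p r))%E])
  /\ doubling_weight (@jacobi_weight R d beta gamma)
  /\ doubling_index (@jacobi_weight R d beta gamma)
       (d%:R + 2 * Num.max 0 (beta + d%:R / 2)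
             + 2 * Num.max 0 (gamma + 1 / 2)).
Proof.
split; last first.
  by split; [exact: doubling_weight_jacobi|exact: doubling_index_jacobi].
move=> r0 r00; have [c [C [c0 C0 h]]] := cap_mass_two_sided hd hbeta hgamma r00.
have k0 := jacobi_const_gt0 hd hbeta hgamma.
set k := jacobi_const beta gamma in k0.
(* The bound is here compared with the mass, not the mass with the bound, so the constants are
   inverted; [k] cancels the normalisation of the weight. *)
exists (k * C)^-1, (k * c)^-1; split; [by rewrite invr_gt0 mulr_gt0..|].
move=> p r cp rr0; have [hl hu] := h p r cp rr0.
rewrite -/(@cap_bound R d beta gamma p.2 r) /jacobi_mass -/k !muleA -!EFinM.
have -> : (k * C)^-1 * k = C^-1 by field; rewrite !gt_eqF.
have -> : (k * c)^-1 * k = c^-1 by field; rewrite !gt_eqF.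
apply/andP; split.
  apply: (@le_trans _ _ (C^-1%:E * (C * @cap_bound R d beta gamma p.2 r)%:E)%E).
    by apply: lee_wpmul2l => //; rewrite lee_fin invr_ge0 ltW.
  by rewrite -EFinM mulKf// gt_eqF.
apply: (@le_trans _ _ (c^-1%:E * (c * @cap_bound R d beta gamma p.2 r)%:E)%E).
  by rewrite -EFinM mulKf// gt_eqF.
by apply: lee_wpmul2l => //; rewrite lee_fin invr_ge0 ltW.
Qed.
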